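(* Let $k\ge 2$, let $a=(a_1,\ldots,a_k)$ with $a_i>0$ for every $i$, let $A:=\sum_{i=1}^k a_i$, and let $p_{\pi_a}(y\mid x)$ be the Bayesian predictive density based on the Dirichlet prior $\pi_a$. Suppose that $\{\varepsilon_N\}$ is a decreasing sequence of real numbers such that $\lim_{N\to\infty}\varepsilon_N=0$, $\lim_{N\to\infty}N\varepsilon_N=\infty$, and $0<\varepsilon_N<1/k$ for every $N$. Then the risk function $R(\theta,p_{\pi_a}(y\mid x))$ satisfies, as $N\to\infty$, $$\begin{aligned} \sup_{\theta\in\Delta_{\varepsilon_N}}\Biggl|&R(\theta,p_{\pi_a}(y\mid x))-\frac{k-1}{2N}-\frac1{N^2}\biggl\{\sum_{i=1}^k\frac{1}{12\theta_i}(6a_i^2-12a_i+5)-\frac12A^2+A-\frac12k+\frac1{12}\biggr\}\\ &-\frac1{N^3}\biggl\{\sum_{i=1}^k\frac{1}{12\theta_i^2}(-4a_i^3+18a_i^2-24a_i+9)+\sum_{i=1}^k\frac1{4\theta_i}(-6a_i^2+12a_i-5)+\frac13A^3-A+\frac12k\biggr\}\\ &-\frac1{N^4}\biggl\{\sum_{i=1}^k\frac1{120\theta_i^3}(30a_i^4-240a_i^3+660a_i^2-720a_i+251)+\sum_{i=1}^k\frac1{2\theta_i^2}(4a_i^3-18a_i^2+24a_i-9)\\ &\qquad+\sum_{i=1}^k\frac1{12\theta_i}(42a_i^2-84a_i+35)-\frac14A^4+A-\frac12k-\frac1{120}\biggr\}\Biggr|=\mathrm{O}(N^{-5}\varepsilon_N^{-4}).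 \end{aligned}$$
   Context: Fix an integer $k\ge 2$. The parameter space is $\Delta=\{\theta=(\theta_1,\ldots,\theta_{k-1}) : \theta_i\ge 0\ (i=1,\ldots,k)\}$ with $\theta_k:=1-\sum_{i=1}^{k-1}\theta_i$, and for $0<\varepsilon<1/k$, $\Delta_\varepsilon=\{\theta\in\Delta:\theta_i\ge\varepsilon\ (i=1,\ldots,k)\}$. For sample size $N$ and given $\theta$, the data $x=(x_1,\ldots,x_{k-1})$, with $x_k:=N-\sum_{i=1}^{k-1}x_i$, has the multinomial distribution $p(x|\theta)=\binom{N}{x_1,\ldots,x_k}\theta_1^{x_1}\cdots\theta_k^{x_k}$, where $\binom{N}{x_1,\ldots,x_k}=N!/(x_1!\cdots x_k!)$; the future observation $y=(y_1,\ldots,y_{k-1})$, with $y_k:=1-\sum_{i=1}^{k-1}y_i$, is independent of $x$ given $\theta$ and is multinomial with index $1$: $p(y|\theta)=\theta_1^{y_1}\cdots\theta_k^{y_k}$ (exactly one of $y_1,\ldots,y_k$ equals $1$, the others $0$). Thus $p(x,y|\theta)=p(x|\theta)p(y|\theta)$. A predictive density $q(y;x)$ is, for each possible $x$, a probability distribution in $y$. Its risk (average Kullback–Leibler divergence, depending on $N$) is $R(\theta,q(y;x))=\sum_y\sum_x p(x,y|\theta)\log\frac{p(y|\theta)}{q(y;x)}$. The Dirichlet prior is $\pi_a(\theta)=\frac{\Gamma(A)}{\Gamma(a_1)\cdots\Gamma(a_k)}\theta_1^{a_1-1}\cdots\theta_k^{a_k-1}$ (density with respect to $d\theta_1\cdots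 d\theta_{k-1}$ on $\Delta$). Its Bayesian predictive density (posterior mean of $p(y|\theta)$ given $x$) is $p_{\pi_a}(y\mid x)=\frac{\sum_{i=1}^k(x_i+a_i)y_i}{N+A}$. *)

(* Defs.v *)
(* MathComp-Analysis, over an arbitrary [R : realType]. *)
From mathcomp Require Import all_boot all_order all_algebra.
From mathcomp Require Import all_classical all_reals all_analysis.

Set Implicit Arguments.
Unset Strict Implicit.
Unset Printing Implicit Defensive.

Import Order.TTheory GRing.Theory Num.Theory.
Import numFieldNormedType.Exports.

Local Open Scope classical_set_scope.
Local Open Scope ring_scope.

(* A parameter is represented by all [k] of its components, the last one being
   determined by the others through [\sum_i theta i = 1]; likewise for the
   observations below. *)
Definition simplex (R : realType) (k : nat) : set ('I_k -> R) :=
  [set theta | (forall i, 0 <= theta i) /\ \sum_i theta i = 1].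

Definition simplex_ge (R : realType) (k : nat) (e : R) : set ('I_k -> R) :=
  [set theta | simplex theta /\ forall i, e <= theta i].

Definition counts (k n : nat) : {set {ffun 'I_k -> 'I_n.+1}} :=
  [set x : {ffun 'I_k -> 'I_n.+1} | (\sum_i x i)%N == n].

Definition multinomial_pmf (R : realType) (k n : nat) (theta : 'I_k -> R)
    (x : {ffun 'I_k -> 'I_n.+1}) : R :=
  n`!%:R / (\prod_i (x i)`!)%:R * \prod_i theta i ^+ x i.

Definition obs_pmf (R : realType) (k : nat) (theta : 'I_k -> R)
    (y : {ffun 'I_k -> 'I_2}) : R :=
  \prod_i theta i ^+ y i.

Definition kl_risk (R : realType) (k n : nat) (theta : 'I_k -> R)
    (q : {ffun 'I_k -> 'I_2} -> {ffun 'I_k -> 'I_n.+1} -> R) : R :=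
  \sum_(y in counts k 1) \sum_(x in counts k n)
    multinomial_pmf theta x * obs_pmf theta y * ln (obs_pmf theta y / q y x).

(* The library has no Lebesgue measure on R^n; the integral of a nonnegative
   Borel function on R^n is an iterated one-dimensional integral (Tonelli). *)
Fixpoint integral_Rn (R : realType) (n : nat) :
    (n.-tuple R -> \bar R) -> \bar R :=
  match n with
  | 0 => fun f => f [tuple]
  | n'.+1 => fun f => (\int[@lebesgue_measure R]_t
               integral_Rn (fun v : n'.-tuple R => f [tuple of t :: v]))%E
  end.

Definition complete_coords (R : realType) (k : nat) (v : k.-1.-tuple R) :
    'I_k -> R :=
  fun i => if (i < k.-1)%N then nth 0 v i else 1 - \sum_(j < k.-1) tnth v j.

(* Integration over the simplex with respect to the first [k - 1] components;
   meant for nonnegative integrands. *)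
Definition simplex_integral (R : realType) (k : nat) (f : ('I_k -> R) -> R) :
    \bar R :=
  integral_Rn (fun v : k.-1.-tuple R =>
    (f (complete_coords v) * \1_(simplex (k := k)) (complete_coords v))%:E).

Definition Gamma (R : realType) (a : R) : R :=
  \int[@lebesgue_measure R]_(t in `]0, +oo[) (t `^ (a - 1) * expR (- t)).

(* On the boundary of the simplex, a null set, [0 `^ b = (b == 0)%:R]. *)
Definition dirichlet (R : realType) (k : nat) (a : 'I_k -> R)
    (theta : 'I_k -> R) : R :=
  Gamma (\sum_i a i) / (\prod_i Gamma (a i)) * \prod_i theta i `^ (a i - 1).

Definition bayes_predictive (R : realType) (k n : nat)
    (prior : ('I_k -> R) -> R)
    (y : {ffun 'I_k -> 'I_2}) (x : {ffun 'I_k -> 'I_n.+1}) : R :=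
  fine (simplex_integral (fun theta =>
          obs_pmf theta y * (multinomial_pmf theta x * prior theta)))
  / fine (simplex_integral (fun theta =>
          multinomial_pmf theta x * prior theta)).

(* Main.v *)
(* With [phi_r x = 1 / ((x + 1) ... (x + r))] and [X_i] binomial of parameters
   [N] and [t_i], the risk at [t] is
   [R_N = sum t_i ln t_i + ln (N + A) - sum t_i E_N ln (X_i + a_i)].  Increments
   in the sample size are [E_(N+1) f X - E_N f X = t E_N (f (X + 1) - f X)], the
   logarithm satisfies [ln (1 + 1 / (x + a)) = sum_(r <= 5) c_r(a) phi_r x
   + O (phi_6 x)], and [E_N phi_r X = t ^- r phi_r N] up to a tail smaller than
   any power of [1 / (N t)].  Hence [R_N - R_(N+1)] is an explicit combination of
   [phi_2 N, ..., phi_5 N] up to an error [O (eps ^- 4 N ^- 6)].  Since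
   [r phi_(r+1) N = phi_r N - phi_r (N + 1)] and the risk vanishes at infinity,
   summing from [N] to infinity expands [R_N] in the [phi_r N], hence in powers
   of [1 / N].  The predictive density follows from Tonelli's theorem: powers of
   positive parts are closed under convolution, up to a Beta factor [B p q] with
   [B p (q + 1) = q / (p + q) B p q]. *)
Require Import Defs.
From mathcomp Require Import all_boot all_order all_algebra.
From mathcomp Require Import all_classical all_reals all_analysis.
From mathcomp Require Import measurable_realfun.
From mathcomp Require Import zify ring lra.

Set Implicit Arguments.
Unset Strict Implicit.
Unset Printing Implicit Defensive.

Import Order.TTheory GRing.Theory Num.Theory.
Import numFieldNormedType.Exports.

Local Open Scope classical_set_scope.
Local Open Scope ring_scope.

(** Expanding [ln] around the mean of [X_i] would need central moments and a separate treatment of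
    counts near [0], where the Taylor series fails. An increment of the logarithm is instead
    approximated by inverse rising factorials with an error valid at every count, [0] included, and
    their binomial expectations are exact up to a multiple of the probability of a zero count. The
    parameter stays fixed while the sample size runs from [N] to infinity, so only [N theta_i >= 1]
    is required. The remainder [t (n t) ^- 6] of an increment, weighted by [t], is [t ^- 4 n ^- 6]:
    this produces [eps ^- 4] and, after summation, [N ^- 5]. On the Dirichlet side the values of
    [Gamma] cancel, but every integral must be shown finite and positive, because [fine] sends an
    infinite value to [0]. *)

(** * Binomial expectations of inverse rising factorials *)

(* Expectation of [f] under the binomial distribution of parameters [n] and [t],
   conditioning on the outcome of one trial. *)
Fixpoint bexp (R : realType) (t : R) (n : nat) (f : nat -> R) : R :=
  if n is n'.+1 then t * bexp t n' (fun j => f j.+1) + (1 - t) * bexp t n' f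
  else f 0%N.

Section binomial_expectation.
Context {R : realType} (t : R).
Implicit Types (f g : nat -> R) (n r : nat).

Lemma eq_bexp f g n : f =1 g -> bexp t n f = bexp t n g.
Proof. by move=> fg; congr bexp; exact/funext. Qed.

Lemma bexp_lin f g b n :
  bexp t n (fun j => f j + b * g j) = bexp t n f + b * bexp t n g.
Proof.
elim: n f g => [//|n IHn] f g /=.
rewrite (IHn (fun j => f j.+1) (fun j => g j.+1)) IHn; ring.
Qed.

Lemma bexp_cst b n : bexp t n (fun=> b) = b.
Proof. by elim: n => //= n ->; ring. Qed.

Lemma bexpZ f b n : bexp t n (fun j => b * f j) = b * bexp t n f.
Proof.
have := bexp_lin (fun=> 0) f b n; rewrite bexp_cst add0r => <-.
by apply: eq_bexp => j; rewrite add0r.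
Qed.

Lemma bexpD f g n : bexp t n (fun j => f j + g j) = bexp t n f + bexp t n g.
Proof.
rewrite -[bexp t n g]mul1r -bexp_lin.
by apply: eq_bexp => j; rewrite mul1r.
Qed.

Lemma bexpB f g n : bexp t n (fun j => f j - g j) = bexp t n f - bexp t n g.
Proof.
rewrite -[bexp t n g]mul1r -mulNr -bexp_lin.
by apply: eq_bexp => j; rewrite mulN1r.
Qed.

Lemma bexp_step f n :
  bexp t n.+1 f - bexp t n f = t * bexp t n (fun j => f j.+1 - f j).
Proof. rewrite bexpB /=; ring. Qed.

(** The count is a sum of [n.+1] exchangeable trials: each succeeds with probability [t], and given
    its success the others form a binomial count over [n] trials. *)
Lemma bexp_size_bias f n :
  bexp t n.+1 (fun j => j%:R * f j) = n.+1%:R * t * bexp t n (fun j => f j.+1).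
Proof.
elim: n f => [|n IHn] f; first by rewrite /=; ring.
rewrite [LHS]/= -/(bexp t n.+1 (fun j => j.+1%:R * f j.+1)).
rewrite -/(bexp t n.+1 (fun j => j%:R * f j)) IHn.
rewrite (@eq_bexp _ (fun j => f j.+1 + 1 * (j%:R * f j.+1))); last first.
  by move=> j; rewrite -natr1; ring.
by rewrite bexp_lin (IHn (fun j => f j.+1)) /= -!natr1; ring.
Qed.

Lemma bexp_eq0 n : bexp t n (fun j => (j == 0)%:R) = (1 - t) ^+ n.
Proof.
elim: n => //= n ->.
by rewrite (@eq_bexp _ (fun=> 0)) // bexp_cst exprS; ring.
Qed.

Hypothesis t01 : 0 < t <= 1.

Lemma le_bexp f g n : (forall j, f j <= g j) -> bexp t n f <= bexp t n g.
Proof.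
case/andP: t01 => t0 t1.
elim: n f g => [|n IHn] f g fg /=; first exact: fg.
by apply: lerD; apply: ler_wpM2l; rewrite ?subr_ge0 ?(ltW t0)// IHn.
Qed.

Lemma bexp_le_norm f g n : (forall j, `|f j| <= g j) ->
  `|bexp t n f| <= bexp t n g.
Proof.
move=> fg; rewrite ler_norml -[- bexp t n g]mulN1r -bexpZ; apply/andP; split.
  apply: le_bexp => j; rewrite mulN1r.
  by have := fg j; rewrite ler_norml => /andP[].
by apply: le_bexp => j; exact: le_trans (ler_norm _) (fg j).
Qed.

End binomial_expectation.

(* [1 / ((n + 1) (n + 2) ... (n + r))]. *)
Definition inv_rise {R : realType} (r n : nat) : R := n`!%:R / (n + r)`!%:R.

Section inv_rise.
Context {R : realType}.
Local Notation phi := (@inv_rise R).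

Lemma inv_rise_gt0 r n : 0 < phi r n.
Proof. by rewrite divr_gt0// ltr0n fact_gt0. Qed.

Lemma inv_rise0 n : phi 0 n = 1.
Proof. by rewrite /inv_rise addn0 divff// pnatr_eq0 -lt0n fact_gt0. Qed.

Lemma inv_riseS r n : phi r.+1 n = phi r n / (n + r.+1)%:R.
Proof.
rewrite /inv_rise addnS factS natrM invfM; ring.
Qed.

Lemma inv_rise_shift r n : n.+1%:R * phi r.+1 n = phi r n.+1.
Proof. by rewrite /inv_rise -addSnnS factS natrM mulrA. Qed.

Lemma inv_rise_le r n : (0 < n)%N -> phi r n <= n%:R ^- r.
Proof.
move=> n0; elim: r => [|r IHr]; first by rewrite inv_rise0 expr0 invr1.
rewrite inv_riseS exprSr invfM; apply: ler_pM => //.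
- exact/ltW/inv_rise_gt0.
- by rewrite lef_pV2 ?posrE ?ltr0n ?addn_gt0 ?n0// ler_nat leq_addr.
Qed.

Lemma inv_rise_telescope r n :
  phi r.+1 n - phi r.+1 n.+1 = r.+1%:R * phi r.+2 n.
Proof.
have phiE : phi r.+1 n = (n + r.+2)%:R * phi r.+2 n.
  by rewrite (inv_riseS r.+1) mulrC divfK// pnatr_eq0 addnS.
rewrite -inv_rise_shift phiE natrD -!natr1; ring.
Qed.

End inv_rise.

Section bexp_inv_rise.
Context {R : realType} (t : R) (t01 : 0 < t <= 1).
Local Notation phi := (@inv_rise R).

(** Size bias turns [j * phi r.+1 j.-1] into [phi r j] for [j > 0]; at [j = 0] the product is [0]
    instead of [1 / r!], hence the correction by the probability of a zero count. *)
Lemma bexp_inv_riseS r n : n.+1%:R * t * bexp t n (phi r.+1) =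
  bexp t n.+1 (phi r) - (1 - t) ^+ n.+1 / r`!%:R.
Proof.
rewrite -(bexp_size_bias _ (fun j => phi r.+1 j.-1)).
rewrite mulrC -bexp_eq0 -bexpZ -bexpB; apply: eq_bexp => -[|j].
  by rewrite mul0r eqxx mulr1 /inv_rise add0n fact0 div1r subrr.
by rewrite /= inv_rise_shift mulr0 subr0.
Qed.

Definition inv_rise_defect r n := t ^- r * phi r n - bexp t n (phi r).

(** [t ^- r * phi r n] obeys the recursion of [bexp_inv_riseS] without its correction, so the defect
    is fed by zero counts only. *)
Lemma inv_rise_defectS r n : n.+1%:R * t * inv_rise_defect r.+1 n =
  inv_rise_defect r n.+1 + (1 - t) ^+ n.+1 / r`!%:R.
Proof.
case/andP: t01 => t0 _.
rewrite /inv_rise_defect mulrBr bexp_inv_riseS -inv_rise_shift exprSr.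
have : t ^+ r != 0 by rewrite expf_neq0 ?gt_eqF.
have : r`!%:R != 0 :> R by rewrite pnatr_eq0 -lt0n fact_gt0.
move: (t ^+ r) => tr f0 tr0; field.
by apply/and3P; split => //; rewrite gt_eqF.
Qed.

Lemma inv_rise_defect_ge0 r n : 0 <= inv_rise_defect r n.
Proof.
case/andP: t01 => t0 t1.
elim: r n => [|r IHr] n.
  rewrite /inv_rise_defect (@eq_bexp _ _ _ (fun=> 1)); last exact: inv_rise0.
  by rewrite bexp_cst inv_rise0 expr0 invr1 mulr1 subrr.
rewrite -(@pmulr_rge0 _ (n.+1%:R * t)) ?mulr_gt0// inv_rise_defectS.
by rewrite addr_ge0// divr_ge0// exprn_ge0// subr_ge0.
Qed.

Lemma inv_rise_defect_le r n : 1 <= n%:R * t ->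
  inv_rise_defect r n <= r%:R * (1 - t) ^+ n.
Proof.
case/andP: t01 => t0 t1.
elim: r n => [|r IHr] n nt.
  rewrite /inv_rise_defect (@eq_bexp _ _ _ (fun=> 1)); last exact: inv_rise0.
  by rewrite bexp_cst inv_rise0 expr0 invr1 mulr1 subrr mul0r.
have nt1 : 1 <= n.+1%:R * t.
  by apply: (le_trans nt); rewrite ler_pM2r// ler_nat.
apply: (@le_trans _ _ (n.+1%:R * t * inv_rise_defect r.+1 n)).
  by rewrite ler_peMl// inv_rise_defect_ge0.
have pow : (1 - t) ^+ n.+1 <= (1 - t) ^+ n.
  by rewrite exprS ler_piMl// ?exprn_ge0 ?subr_ge0// gerBl ltW.
rewrite inv_rise_defectS -natr1 mulrDl mul1r lerD//.
  by apply: (le_trans (IHr _ nt1)); rewrite ler_wpM2l.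
apply: le_trans pow.
rewrite ler_pdivrMr ?ltr0n ?fact_gt0// ler_peMr//.
  by rewrite exprn_ge0// subr_ge0.
by rewrite ler1n fact_gt0.
Qed.

Lemma bexp_inv_rise_le r n : (0 < n)%N ->
  bexp t n (phi r) <= (n%:R * t) ^- r.
Proof.
move=> n0; have := inv_rise_defect_ge0 r n; rewrite subr_ge0 => /le_trans; apply.
case/andP: t01 => t0 t1.
rewrite exprMn invfM mulrC ler_wpM2r ?invr_ge0 ?exprn_ge0 ?(ltW t0)//.
exact: inv_rise_le.
Qed.

(** Since [phi m 0 = 1 / m!], the indicator of [0] lies below [m! * phi m]; taking expectations
    gives decay of any polynomial order in [n t]. *)
Lemma binomial_zero_le m n : (0 < n)%N ->
  (1 - t) ^+ n <= m`!%:R * (n%:R * t) ^- m.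
Proof.
move=> n0; rewrite -bexp_eq0.
apply: (@le_trans _ _ (m`!%:R * bexp t n (phi m))); last first.
  by rewrite ler_wpM2l// bexp_inv_rise_le.
rewrite -bexpZ; apply: le_bexp => // -[|j]; last first.
  by rewrite mulr_ge0// ltW// inv_rise_gt0.
by rewrite /inv_rise add0n fact0 div1r divff// pnatr_eq0 -lt0n fact_gt0.
Qed.

Lemma bexp_inv_rise_approx m r n : 1 <= n%:R * t ->
  `|bexp t n (phi r) - t ^- r * phi r n| <= (r * m`!)%:R * (n%:R * t) ^- m.
Proof.
move=> nt; have n0 : (0 < n)%N.
  by case: n nt => //; rewrite mul0r ler10.
rewrite distrC ger0_norm ?inv_rise_defect_ge0//.
apply: (le_trans (inv_rise_defect_le r nt)).
by rewrite natrM -mulrA ler_wpM2l// binomial_zero_le.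
Qed.

End bexp_inv_rise.

(** * Increments of the logarithm *)

Section ln_step.
Context {R : realType}.
Local Notation phi := (@inv_rise R).

Definition ln_taylor5 (u : R) : R :=
  u - u ^+ 2 / 2 + u ^+ 3 / 3 - u ^+ 4 / 4 + u ^+ 5 / 5.

Lemma ln_taylor5_le (u : R) : 0 <= u -> `|ln (1 + u) - ln_taylor5 u| <= u ^+ 6.
Proof.
rewrite le_eqVlt => /predU1P[<-|u0].
  by rewrite addr0 ln1 /ln_taylor5 !expr0n /= !mul0r !(subr0, addr0) normr0.
(* [1 - x + x ^+ 2 - x ^+ 3 + x ^+ 4] equals [(1 + x ^+ 5) / (1 + x)], so only this term survives in
   the derivative. *)
have drv (x : R) : 0 <= x -> is_derive x 1 (fun v => ln (1 + v) - ln_taylor5 v)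
    (- (x ^+ 5 / (1 + x))).
  move=> x0; have x1 : 0 < 1 + x by rewrite ltr_wpDr.
  have dln : is_derive x 1 (fun v => ln (1 + v)) (1 + x)^-1.
    have d1 : is_derive x 1 (fun v : R => 1 + v) 1.
      by apply: is_derive_eq; rewrite add0r mulr1.
    rewrite -[X in is_derive _ _ _ X]mulr1.
    exact: (@is_derive1_comp _ (@ln R) (fun v => 1 + v) x _ _ (is_derive1_ln x1) d1).
  rewrite /ln_taylor5; apply: is_derive_eq.
  rewrite /GRing.scale /= ; field.
  by rewrite gt_eqF.
have [||c] := @MVT R (fun v => ln (1 + v) - ln_taylor5 v)
   (fun x => - (x ^+ 5 / (1 + x))) 0 u u0.
- by move=> x /itvP xI; apply: drv; rewrite xI.
- apply: derivable_within_continuous => x /itvP xI.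
  by have [] := drv x; rewrite ?xI.
rewrite /= => /itvP cI; rewrite addr0 ln1 /ln_taylor5 !expr0n /= !mul0r !(subr0, addr0) => ->.
have c0 : 0 < c by rewrite cI.
have cu : c < u by rewrite cI.
have [c0' u0'] := (ltW c0, ltW u0).
rewrite normrM normrN !ger0_norm ?divr_ge0 ?exprn_ge0 ?addr_ge0//.
rewrite (exprSr u) ler_pM2r// ler_pdivrMr ?ltr_wpDr//.
apply: (@le_trans _ _ (u ^+ 5)); first by rewrite lerXn2r ?nnegrE// ltW.
by rewrite ler_peMr ?exprn_ge0// lerDl.
Qed.

(** As [phi r x] is [1 / (r - 1)!] times the integral of [(1 - u) ^ x * u ^ (r - 1)] over the unit
    interval, [ln_coef a r] is [(r - 1)!] times the coefficient of [u ^ (r - 1)] in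
    [(1 - u) ^ (a - 1) * u / (- ln (1 - u))]. Entry [0] is a filler. *)
Definition ln_coef (a : R) (r : nat) : R :=
  nth 0 [:: 0; 1; 1 / 2 - a; (6 * a ^+ 2 - 12 * a + 5) / 6;
    (- 4 * a ^+ 3 + 18 * a ^+ 2 - 24 * a + 9) / 4;
    (30 * a ^+ 4 - 240 * a ^+ 3 + 660 * a ^+ 2 - 720 * a + 251) / 30] r.

(* Numerator, as a polynomial in [z], of the difference between
   [ln_taylor5 (z - b)^-1] and the expansion in inverse rising factorials
   [1 / (z (z + 1) ... (z + r - 1))], over [60 (z - b)^5 z (z + 1) ... (z + 4)]. *)
Definition ln_step_num (b : R) (d : nat) : R :=
  nth 0 [:: 502 * b ^+ 5 + 1440 * b ^+ 6 + 1320 * b ^+ 7 + 480 * b ^+ 8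
      + 60 * b ^+ 9;
    288 + 360 * b + 480 * b ^+ 2 + 720 * b ^+ 3 - 1070 * b ^+ 4
      - 5065 * b ^+ 5 - 5040 * b ^+ 6 - 1890 * b ^+ 7 - 240 * b ^+ 8;
    240 - 210 * b - 1160 * b ^+ 2 + 760 * b ^+ 3 + 6725 * b ^+ 4
      + 7220 * b ^+ 5 + 2790 * b ^+ 6 + 360 * b ^+ 7;
    150 + 685 * b - 180 * b ^+ 2 - 4000 * b ^+ 3 - 4600 * b ^+ 4
      - 1830 * b ^+ 5 - 240 * b ^+ 6;
    - 125 + 900 * b ^+ 2 + 1100 * b ^+ 3 + 450 * b ^+ 4 + 60 * b ^+ 5] d.

(** Over a denominator of degree [10] in [z] the numerator could have degree [9]; the five
    coefficients are those that cancel degrees [9] down to [5], leaving order [z ^- 6]. *)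
Lemma ln_step_numE (a z : R) : 0 < z -> 0 < z + a - 1 ->
  ln_taylor5 (z + a - 1)^-1 - (1 / z + ln_coef a 2 / (z * (z + 1))
    + ln_coef a 3 / (z * (z + 1) * (z + 2))
    + ln_coef a 4 / (z * (z + 1) * (z + 2) * (z + 3))
    + ln_coef a 5 / (z * (z + 1) * (z + 2) * (z + 3) * (z + 4)))
  = (\sum_(d < 5) ln_step_num (1 - a) d * z ^+ d)
    / (60 * (z + a - 1) ^+ 5 * (z * (z + 1) * (z + 2) * (z + 3) * (z + 4))).
Proof.
move=> z0 y0; rewrite !big_ord_recr big_ord0 /= /ln_step_num /ln_coef /ln_taylor5 /=.
have h n : z + n%:R != 0 by rewrite gt_eqF// ltr_wpDr.
have z1 : z + 1 != 0 by rewrite gt_eqF// ltr_wpDr.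
by field; rewrite !h z1 !gt_eqF.
Qed.

Lemma inv_rise_prod (x : nat) : let z : R := x.+1%:R in
  [/\ phi 1 x = 1 / z, phi 2 x = 1 / (z * (z + 1)),
   phi 3 x = 1 / (z * (z + 1) * (z + 2)),
   phi 4 x = 1 / (z * (z + 1) * (z + 2) * (z + 3)) &
   phi 5 x = 1 / (z * (z + 1) * (z + 2) * (z + 3) * (z + 4))].
Proof.
have zE r : (x + r.+1)%:R = x.+1%:R + r%:R :> R by rewrite -natrD addSnnS.
move=> z; rewrite !inv_riseS !inv_rise0 !zE addr0.
by split; rewrite ?div1r ?invfM ?mulrA.
Qed.

(** Factor by factor, [x + s <= s (x + 1)] for [s >= 1]. Remainders in powers of [x.+1] thus become
    multiples of [phi r], whose binomial expectation is under control. *)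
Lemma exprV_le_inv_rise r (x : nat) : x.+1%:R ^- r <= r`!%:R * phi r x.
Proof.
elim: r => [|r IHr]; first by rewrite inv_rise0 expr0 invr1 mulr1.
have z0 : 0 < x.+1%:R :> R by [].
have y0 : 0 < (x + r.+1)%:R :> R by rewrite ltr0n addnS.
rewrite inv_riseS factS natrM exprSr invfM.
rewrite (_ : _ * _ = (r`!%:R * phi r x) * (r.+1%:R / (x + r.+1)%:R)); last ring.
apply: ler_pM => //; rewrite ?invr_ge0 ?exprn_ge0//.
rewrite ler_pdivlMr// mulrC ler_pdivrMr// -natrM ler_nat.
by rewrite mulSn mulnS addnS addSn ltnS addnA leq_addr.
Qed.

Lemma ln_step (a : R) : 0 < a -> exists2 K : R, 0 <= K & forall x : nat,
  `|ln (x.+1%:R + a) - ln (x%:R + a) - \sum_(1 <= r < 6) ln_coef a r * phi r x|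
  <= K * phi 6 x.
Proof.
move=> a0.
(* [m * (x + 1) <= x + a] for every count, so [x = 0] is no exception. *)
pose m := Num.min a 1.
have m0 : 0 < m by rewrite lt_min a0 ltr01.
pose Q := \sum_(d < 5) `|ln_step_num (1 - a) d|.
have Q0 : 0 <= Q by apply: sumr_ge0.
(* [m ^- 6] comes from the Taylor remainder, [Q / 60 * m ^- 5] from the numerator in [ln_step_numE],
   and [6!] from trading [z ^- 6] for [phi 6 x]. *)
exists ((m ^- 6 + Q / 60 * m ^- 5) * 6`!%:R).
  by rewrite mulr_ge0// addr_ge0 ?mulr_ge0 ?invr_ge0 ?exprn_ge0 ?(ltW m0).
move=> x; have := inv_rise_prod x; have := @exprV_le_inv_rise 6 x.
have : 1 <= x.+1%:R :> R by rewrite ler1n.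
have : x%:R = x.+1%:R - 1 :> R by rewrite -natr1 addrK.
move: (x.+1%:R : R) => z xE z1 phi6 [p1 p2 p3 p4 p5].
have z0 : 0 < z by exact: lt_le_trans z1.
have yE : x%:R + a = z + a - 1 by rewrite xE addrAC.
have y0 : 0 < z + a - 1 by rewrite -yE ltr_wpDl.
have my : m * z <= z + a - 1.
  rewrite -yE -[z](subrK 1) -xE mulrDr mulr1 lerD ?ge_min ?lexx//.
  by rewrite ler_piMl// ge_min lexx orbT.
have lnE : ln (z + a) - ln (x%:R + a) = ln (1 + (z + a - 1)^-1).
  rewrite yE -ln_div ?posrE ?(addr_gt0 z0 a0)//; congr ln.
  by field; rewrite gt_eqF.
rewrite lnE.
have := ln_step_numE z0 y0.
do 5 rewrite big_nat_recr//=.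
rewrite big_geq// add0r [ln_coef a 1]/ln_coef /=.
rewrite p1 p2 p3 p4 p5 !div1r ?mul1r.
set S := (X in _ - X = _); rewrite -/S => numE.
rewrite -[X in _ <= X]mulrA mulrDl.
have ineq : (m ^- 6 + Q / 60 * m ^- 5) * z ^- 6 <=
    m ^- 6 * (6`!%:R * phi 6 x) + Q / 60 * m ^- 5 * (6`!%:R * phi 6 x).
  rewrite mulrDl lerD// ler_wpM2l ?phi6//.
    by rewrite invr_ge0 exprn_ge0// ltW.
  by rewrite !mulr_ge0// invr_ge0 exprn_ge0// ltW.
apply: le_trans ineq.
have [m0' z0' y0'] := And3 (ltW m0) (ltW z0) (ltW y0).
have mz0 : 0 <= m * z by exact: mulr_ge0.
rewrite -(subrK (ln_taylor5 (z + a - 1)^-1) (ln _)) -addrA mulrDl.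
apply: (le_trans (ler_normD _ _)); apply: lerD.
  apply: (le_trans (ln_taylor5_le _)); first by rewrite invr_ge0 ltW.
  rewrite -invfM -exprMn exprVn lef_pV2 ?posrE ?exprn_gt0 ?mulr_gt0//.
  by rewrite lerXn2r ?nnegrE.
rewrite numE normrM normfV.
have den0 : 0 < 60 * (z + a - 1) ^+ 5 * (z * (z + 1) * (z + 2) * (z + 3) * (z + 4)).
  have y5 : 0 < (z + a - 1) ^+ 5 by rewrite exprn_gt0.
  by rewrite !mulr_gt0// addr_gt0.
rewrite (gtr0_norm den0) ler_pdivrMr//.
have Pz : `|\sum_(d < 5) ln_step_num (1 - a) d * z ^+ d| <= Q * z ^+ 4.
  apply: (le_trans (ler_norm_sum _ _ _)); rewrite mulr_suml ler_sum// => d _.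
  rewrite normrM ler_wpM2l// normrX gtr0_norm// ler_weXn2l//.
  by rewrite -ltnS ltn_ord.
apply: (le_trans Pz).
have -> : Q * z ^+ 4 = Q / 60 / m ^+ 5 / z ^+ 6 * (60 * (m * z) ^+ 5 * z ^+ 5).
  by field; rewrite !gt_eqF.
apply: ler_wpM2l.
  by rewrite !mulr_ge0 ?invr_ge0 ?exprn_ge0.
have zn (n : nat) : 0 <= z <= z + n%:R by rewrite z0' lerDl ler0n.
apply: ler_pM; rewrite ?mulr_ge0 ?exprn_ge0//.
  by rewrite ler_wpM2l// lerXn2r ?nnegrE.
rewrite !exprSr expr0 mul1r.
have zz (u v w : R) : 0 <= u <= v -> z <= w -> 0 <= u * z <= v * w.
  by move=> /andP[u0 uv] zw; rewrite mulr_ge0// ler_pM.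
have [_ z2] := andP (zn 1%N); have [_ z3] := andP (zn 2%N); have [_ z4] := andP (zn 3%N).
have [_ z5] := andP (zn 4%N).
suff /andP[] : 0 <= z * z * z * z * z <= z * (z + 1) * (z + 2) * (z + 3) * (z + 4) by [].
apply: (zz _ _ _ _ z5); apply: (zz _ _ _ _ z4); apply: (zz _ _ _ _ z3).
by apply: (zz _ _ _ _ z2); rewrite z0' lexx.
Qed.

End ln_step.

(** * Binomial expectations of the logarithm *)

Section binomial_log.
Context {R : realType}.
Local Notation phi := (@inv_rise R).

Lemma bexp_sum (t : R) (F : nat -> nat -> R) (s : seq nat) n :
  bexp t n (fun j => \sum_(r <- s) F r j) = \sum_(r <- s) bexp t n (F r).
Proof.
elim: s => [|r s IHs].
  by under [in LHS]eq_bexp do rewrite big_nil; rewrite bexp_cst big_nil.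
by under [in LHS]eq_bexp do rewrite big_cons; rewrite bexpD IHs big_cons.
Qed.

Lemma bexp_ln_step (a : R) : 0 < a -> exists2 K : R, 0 <= K &
  forall (t : R) n, 0 < t <= 1 -> 1 <= n%:R * t ->
  `|bexp t n.+1 (fun j => ln (j%:R + a)) - bexp t n (fun j => ln (j%:R + a))
    - t * \sum_(1 <= r < 6) ln_coef a r * (t ^- r * phi r n)|
  <= K * (t * (n%:R * t) ^- 6).
Proof.
move=> a0; have [K K0 HK] := ln_step a0.
(* Cost of replacing each [bexp t n (phi r)] by [t ^- r * phi r n], with tails of order [6]. *)
pose B := \sum_(1 <= r < 6) `|ln_coef a r| * (r * 6`!)%:R.
have B0 : 0 <= B by apply: sumr_ge0 => r _; rewrite mulr_ge0.
exists (K + B); first exact: addr_ge0.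
move=> t n t01 nt; have /andP[t0 t1] := t01.
have n0 : (0 < n)%N by case: n nt => //; rewrite mul0r ler10.
rewrite bexp_step -mulrBr normrM gtr0_norm// mulrCA ler_pM2l// mulrDl.
set T := \sum_(_ <= _ < _) _.
have -> : bexp t n (fun j => ln (j.+1%:R + a) - ln (j%:R + a)) - T =
  bexp t n (fun j => ln (j.+1%:R + a) - ln (j%:R + a)
     - \sum_(1 <= r < 6) ln_coef a r * phi r j)
  + \sum_(1 <= r < 6) ln_coef a r * (bexp t n (phi r) - t ^- r * phi r n).
  rewrite (bexpB _ (fun j => ln (j.+1%:R + a) - ln (j%:R + a))) bexp_sum.
  under [X in _ = _ - X + _]eq_bigr do rewrite bexpZ.
  under [X in _ = _ + X]eq_bigr do rewrite mulrBr.
  by rewrite sumrB -/T addrA subrK.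
apply: (le_trans (ler_normD _ _)); apply: lerD.
  apply: (le_trans (bexp_le_norm t01 n HK)).
  by rewrite bexpZ ler_wpM2l// bexp_inv_rise_le.
apply: (le_trans (ler_norm_sum _ _ _)); rewrite mulr_suml ler_sum// => r _.
by rewrite normrM -mulrA ler_wpM2l// bexp_inv_rise_approx.
Qed.

Lemma bexp_id (t : R) n : bexp t n (fun j => j%:R) = n%:R * t.
Proof.
case: n => [|n]; first by rewrite mul0r.
rewrite (@eq_bexp _ _ _ (fun j => j%:R * 1)) => [|j]; last by rewrite mulr1.
by rewrite (bexp_size_bias _ (fun=> 1)) bexp_cst mulr1.
Qed.

(** The coefficient [1] of [phi 1] matters: in [bexp_ln_bound], multiplied by [n t], it cancels the
    [- 1] of [ln y <= y - 1]. *)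
Lemma inv_shift_le (a : R) : 0 < a -> exists2 K : R, 0 <= K &
  forall j : nat, (j%:R + a)^-1 <= phi 1 j + K * phi 2 j.
Proof.
move=> a0; pose m := Num.min a 1.
have m0 : 0 < m by rewrite lt_min a0 ltr01.
exists (`|1 - a| / m * 2) => [|j]; first by rewrite !mulr_ge0 ?invr_ge0 ?(ltW m0).
have z0 : 0 < j.+1%:R :> R by [].
have y0 : 0 < j%:R + a by rewrite ltr_wpDl.
have myz : m * j.+1%:R <= j%:R + a.
  rewrite -natr1 mulrDr mulr1 lerD ?ge_min ?lexx//.
  by rewrite ler_piMl// ge_min lexx orbT.
have -> : (j%:R + a)^-1 = phi 1 j + (1 - a) / (j.+1%:R * (j%:R + a)).
  rewrite !inv_riseS inv_rise0 addn1 -natr1.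
  by field; rewrite !gt_eqF// natr1.
rewrite lerD2l; apply: (@le_trans _ _ (`|1 - a| / m * j.+1%:R ^- 2)).
  apply: (@le_trans _ _ (`|1 - a| / (j.+1%:R * (j%:R + a)))).
    by rewrite ler_wpM2r ?ler_norm// invr_ge0 mulr_ge0// ltW.
  rewrite -mulrA -invfM ler_wpM2l// lef_pV2 ?posrE ?mulr_gt0 ?exprn_gt0//.
  by rewrite expr2 mulrCA ler_pM2l.
rewrite -[_ * 2 * _]mulrA ler_wpM2l ?mulr_ge0 ?invr_ge0 ?(ltW m0)//.
exact: (@exprV_le_inv_rise R 2 j).
Qed.

(* [ln x <= x - 1], applied both to [x = (X + a) / (n t)] and to its inverse. *)
Lemma bexp_ln_bound (a : R) : 0 < a -> exists2 K : R, 0 <= K &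
  forall (t : R) n, 0 < t <= 1 -> (0 < n)%N ->
  1 <= n%:R * t ->
  `|bexp t n (fun j => ln (j%:R + a)) - ln (n%:R * t)| <= K / (n%:R * t).
Proof.
move=> a0; have [K K0 HK] := inv_shift_le a0.
exists (a + K); first by rewrite addr_ge0// ltW.
move=> t n t01 n0 nt; have /andP[t0 t1] := t01.
set l := n%:R * t.
have l0 : 0 < l by rewrite mulr_gt0// ltr0n.
have ja j : 0 < j%:R + a :> R by rewrite ltr_wpDl.
have lnle (y : R) : 0 < y -> ln y <= y - 1.
  move=> y0; have := @le_ln1Dx R (y - 1); rewrite (addrC 1) subrK; apply.
  by rewrite ltrBrDr addNr.
have upper : bexp t n (fun j => ln (j%:R + a)) - ln l <= a / l.
  rewrite -[X in _ - X](bexp_cst t _ n) -bexpB.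
  apply: (@le_trans _ _ (bexp t n (fun j => l^-1 * (j%:R + a) - 1))).
    apply: le_bexp => // j; rewrite -ln_div ?posrE//.
    by rewrite mulrC; apply: lnle; rewrite mulr_gt0 ?invr_gt0.
  rewrite bexpB bexpZ bexpD !bexp_cst bexp_id -/l.
  by rewrite mulrDr mulVf ?gt_eqF// addrAC subrr add0r mulrC.
have lower : ln l - bexp t n (fun j => ln (j%:R + a)) <= K / l.
  rewrite -[X in X - _](bexp_cst t _ n) -bexpB.
  apply: (@le_trans _ _ (bexp t n (fun j => l * (phi 1 j + K * phi 2 j) - 1))).
    apply: le_bexp => // j; rewrite -ln_div ?posrE//.
    apply: le_trans (lnle _ _) _; first by rewrite divr_gt0.
    by rewrite lerD2r ler_pM2l.
  rewrite bexpB bexpZ bexpD bexpZ bexp_cst.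
  have -> : K / l = l * (l ^- 1 + K * l ^- 2) - 1 by field; rewrite gt_eqF.
  by rewrite lerD2r ler_pM2l// lerD// ?ler_wpM2l// bexp_inv_rise_le.
have al0 : 0 <= a / l by rewrite divr_ge0 ?(ltW a0) ?(ltW l0).
have Kl0 : 0 <= K / l by rewrite divr_ge0 ?(ltW a0) ?(ltW l0).
by rewrite ler_norml mulrDl; apply/andP; split; lra.
Qed.

(** Increments are summed to infinity; the bound [B / n] only makes [u] vanish there. [B] does not
    reach the conclusion, so it may depend on the parameter. *)
Lemma telescoping_bound (u : nat -> R) (C B : R) (N : nat) : (0 < N)%N -> 0 <= C ->
  (forall n, (N <= n)%N -> `|u n.+1 - u n| <= C * n%:R ^- 6) ->
  (forall n, (N <= n)%N -> `|u n| <= B / n%:R) ->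
  `|u N| <= 32 * C * N%:R ^- 5.
Proof.
move=> N0 C0 du uB.
(* [32] is [2 ^+ 5], from [x + 1 <= 2 * x]. *)
have pow (n : nat) : (0 < n)%N ->
    n%:R ^- 6 <= 32 * (n%:R ^- 5 - n.+1%:R ^- 5) :> R.
  move=> n0; have n1 : 1 <= n%:R :> R by rewrite ler1n.
  rewrite -[n.+1%:R]natr1; move: (n%:R : R) n1 => x x1.
  have x0 : 0 < x by exact: lt_le_trans x1.
  have -> : x ^- 5 - (x + 1) ^- 5 =
      (5 * x ^+ 5 + 10 * x ^+ 4 + 10 * x ^+ 3 + 5 * x ^+ 2 + x)
        / (x ^+ 6 * (x + 1) ^+ 5).
    by field; rewrite !gt_eqF ?addr_gt0.
  have y5 : (x + 1) ^+ 5 <= (2 * x) ^+ 5.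
    by rewrite lerXn2r ?nnegrE ?addr_ge0 ?mulr_ge0 ?(ltW x0)//; lra.
  rewrite mulrA ler_pdivlMr ?mulr_gt0 ?exprn_gt0 ?addr_gt0//.
  rewrite mulrA mulVf ?mul1r ?expf_neq0 ?gt_eqF//.
  apply: (le_trans y5); rewrite exprMn.
  have : 0 <= x ^+ 5 by rewrite exprn_ge0// ltW.
  have : 0 <= x ^+ 4 by rewrite exprn_ge0// ltW.
  have : 0 <= x ^+ 3 by rewrite exprn_ge0// ltW.
  have : 0 <= x ^+ 2 by rewrite exprn_ge0// ltW.
  have -> : 2 ^+ 5 = 32 :> R by ring.
  move: (x ^+ 2) (x ^+ 3) (x ^+ 4) (x ^+ 5) => *; lra.
have main m : `|u N| <= 32 * C * (N%:R ^- 5 - (N + m)%:R ^- 5) + `|u (N + m)%N|.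
  elim: m => [|m IHm]; first by rewrite addn0 subrr mulr0 add0r.
  apply: (le_trans IHm).
  have Nm0 : (0 < N + m)%N by rewrite addn_gt0 N0.
  have := du (N + m)%N (leq_addr _ _); rewrite -addnS => dum.
  have := ler_wpM2l C0 (pow _ Nm0).
  have := ler_distD (u (N + m).+1) (u (N + m)%N) 0.
  rewrite !subr0 distrC -addnS; move: dum.
  move: `|_ - _| `|u (N + m.+1)%N| `|u (N + m)%N| (_ ^- 6) (_ ^- 5) (_ ^- 5) (_ ^- 5).
  move=> *; lra.
apply/ler_addgt0Pr => e e0.
have B0 : 0 <= `|B| / e by rewrite divr_ge0// ltW.
pose m := (Num.bound (`|B| / e)).
have hm : `|B| / e < (N + m)%:R.
  rewrite natrD (lt_le_trans (archi_boundP B0))// lerDr//.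
have Nm0 : 0 < (N + m)%:R :> R by rewrite ltr0n addn_gt0 N0.
apply: (le_trans (main m)); apply: lerD.
  by rewrite ler_wpM2l ?mulr_ge0// gerBl invr_ge0 exprn_ge0.
apply: (le_trans (uB _ (leq_addr _ _))).
rewrite ler_pdivrMr//; apply: (le_trans (ler_norm _)).
by rewrite mulrC -ler_pdivrMr// ltW.
Qed.

End binomial_log.

(** * Expansion of the risk *)

Section binomial_risk.
Context {R : realType} (k : nat) (a : 'I_k -> R).
Hypothesis a0 : forall i, 0 < a i.
Hypothesis k0 : (0 < k)%N.
Local Notation phi := (@inv_rise R).
Local Notation A := (\sum_i a i).

Definition binomial_risk (th : 'I_k -> R) (n : nat) : R :=
  \sum_i th i * (ln (th i) + ln (n%:R + A)
                 - bexp (th i) n (fun j => ln (j%:R + a i))).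

(** Coefficient of [phi r n] in the expected decrease of the risk from [n] to [n.+1]. One factor
    [th i] is the weight in the risk, the other the success probability in a binomial increment;
    [ln_coef A r] belongs to the nonrandom [ln (n + A)]. *)
Definition risk_coef (th : 'I_k -> R) (r : nat) : R :=
  \sum_i th i * th i * (th i ^- r * ln_coef (a i) r) - ln_coef A r.

(** Discrete antiderivative: [phi r / r] drops by exactly [phi r.+1] at each step and vanishes at
    infinity. *)
Definition risk_main (th : 'I_k -> R) (n : nat) : R :=
  \sum_(1 <= r < 5) risk_coef th r.+1 / r%:R * phi r n.

Let A0 : 0 < A.
Proof.
case: k a a0 k0 => // m b b0 _; rewrite big_ord_recl ltr_wpDr//.
by apply: sumr_ge0 => i _; exact: ltW.
Qed.

Let mean_cst (th : 'I_k -> R) (x : R) : \sum_i th i = 1 -> x = \sum_i th i * x.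
Proof. by move=> th1; rewrite -mulr_suml th1 mul1r. Qed.

Lemma risk_main_step (th : 'I_k -> R) n :
  (forall i, 0 < th i) -> \sum_i th i = 1 ->
  risk_main th n - risk_main th n.+1 =
  \sum_(1 <= r < 6) risk_coef th r * phi r n.
Proof.
(* As [ln_coef _ 1 = 1], this coefficient is [\sum_i th i - 1]. A nonzero value would make the
   increments of order [1 / n], hence not summable. *)
move=> th0 th1; have d1 : risk_coef th 1 = 0.
  rewrite /risk_coef /ln_coef /= -[X in _ - X]th1 -sumrB big1// => i _.
  by field; rewrite gt_eqF.
rewrite [RHS]big_ltn// d1 mul0r add0r -sumrB big_add1 /=.
apply: eq_big_nat => r /andP[r1 _].
rewrite -mulrBr; case: r r1 => // r _.
by rewrite inv_rise_telescope mulrA divfK ?pnatr_eq0.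
Qed.

Lemma binomial_risk_step (th : 'I_k -> R) n :
  \sum_i th i = 1 ->
  binomial_risk th n.+1 - binomial_risk th n + \sum_(1 <= r < 6) risk_coef th r * phi r n
  = (ln (n.+1%:R + A) - ln (n%:R + A) - \sum_(1 <= r < 6) ln_coef A r * phi r n)
  - \sum_i th i * (bexp (th i) n.+1 (fun j => ln (j%:R + a i))
     - bexp (th i) n (fun j => ln (j%:R + a i))
     - th i * \sum_(1 <= r < 6) ln_coef (a i) r * (th i ^- r * phi r n)).
Proof.
move=> th1.
have -> : \sum_(1 <= r < 6) risk_coef th r * phi r n =
  \sum_i th i * (th i * \sum_(1 <= r < 6) ln_coef (a i) r * (th i ^- r * phi r n))
  - \sum_(1 <= r < 6) ln_coef A r * phi r n.
  under eq_bigr do rewrite mulrBl mulr_suml.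
  rewrite sumrB exchange_big /=; congr (_ - _); apply: eq_bigr => i _.
  by rewrite !mulr_sumr; apply: eq_bigr => r _; ring.
rewrite -sumrB addrA [X in _ = X - _ - _](mean_cst _ th1).
rewrite -big_split /= addrAC -sumrB; congr (_ - _).
by apply: eq_bigr => i _; ring.
Qed.

(** Comparing the logarithms with [ln n] and [ln (n * th i)] cancels [ln (th i)]; each weight [th i]
    then absorbs the one in [K i / (n * th i)], so the bound is uniform in [th]. *)
Lemma binomial_risk_bound : exists2 K : R, 0 <= K & forall (th : 'I_k -> R) n,
  (forall i, 0 < th i <= 1) -> \sum_i th i = 1 ->
  (forall i, 1 <= n%:R * th i) -> `|binomial_risk th n| <= K / n%:R.
Proof.
have /choice[K HK] : forall i, exists K : R, 0 <= K /\
  forall (t : R) n, 0 < t <= 1 -> (0 < n)%N -> 1 <= n%:R * t ->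
  `|bexp t n (fun j => ln (j%:R + a i)) - ln (n%:R * t)| <= K / (n%:R * t).
  by move=> i; have [K K0 H] := bexp_ln_bound (a0 i); exists K.
exists (A + \sum_i K i).
  by rewrite addr_ge0 ?(ltW A0)// sumr_ge0// => i _; have [] := HK i.
move=> th n th01 th1 nth.
have n0 : (0 < n)%N.
  rewrite lt0n; apply: contraPneq (nth (Ordinal k0)) => ->.
  by rewrite mul0r ler10.
have n0' : 0 < n%:R :> R by rewrite ltr0n.
have lnA : 0 <= ln (n%:R + A) - ln n%:R <= A / n%:R.
  rewrite -ln_div ?posrE ?addr_gt0//; apply/andP; split.
    by rewrite ln_ge0// ler_pdivlMr// mul1r lerDl ltW.
  rewrite mulrDl divff ?gt_eqF//; apply: le_ln1Dx.
  by apply: lt_trans (divr_gt0 A0 n0'); rewrite ltrN10.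
have -> : binomial_risk th n = ln (n%:R + A) - ln n%:R
   - \sum_i th i * (bexp (th i) n (fun j => ln (j%:R + a i)) - ln (n%:R * th i)).
  rewrite [X in _ = X - _](mean_cst _ th1) -sumrB; apply: eq_bigr => i _.
  have /andP[ti0 _] := th01 i.
  by rewrite lnM ?posrE//; ring.
apply: (le_trans (ler_normB _ _)); rewrite mulrDl; apply: lerD.
  by have /andP[l0 lA] := lnA; rewrite ger0_norm.
rewrite mulr_suml; apply: (le_trans (ler_norm_sum _ _ _)); apply: ler_sum => i _.
have /andP[ti0 _] := th01 i.
rewrite normrM gtr0_norm// mulrC -ler_pdivlMr//.
by rewrite -mulrA -invfM; have [_] := HK i; apply.
Qed.

Lemma risk_main_bound (th : 'I_k -> R) : exists B : R, forall n, (0 < n)%N ->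
  `|risk_main th n| <= B / n%:R.
Proof.
exists (\sum_(1 <= r < 5) `|risk_coef th r.+1 / r%:R|) => n n0.
rewrite mulr_suml; apply: (le_trans (ler_norm_sum _ _ _)).
rewrite big_nat_cond [leRHS]big_nat_cond; apply: ler_sum => r /andP[/andP[r1 _] _].
rewrite normrM ler_wpM2l// gtr0_norm ?inv_rise_gt0//.
apply: (le_trans (inv_rise_le _ n0)); rewrite lef_pV2 ?posrE ?exprn_gt0 ?ltr0n//.
by rewrite ler_eXnr ?ler1n.
Qed.

Lemma binomial_risk_expansion : exists2 C : R, 0 <= C &
  forall (th : 'I_k -> R) (e : R) N, 0 < e ->
  (forall i, e <= th i) -> \sum_i th i = 1 -> 1 <= N%:R * e ->
  `|binomial_risk th N - risk_main th N| <= C * (N%:R ^- 5 * e ^- 4).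
Proof.
have /choice[K HK] : forall i, exists K : R, 0 <= K /\
  forall (t : R) n, 0 < t <= 1 -> 1 <= n%:R * t ->
  `|bexp t n.+1 (fun j => ln (j%:R + a i)) - bexp t n (fun j => ln (j%:R + a i))
    - t * \sum_(1 <= r < 6) ln_coef (a i) r * (t ^- r * phi r n)|
  <= K * (t * (n%:R * t) ^- 6).
  by move=> i; have [L L0 H] := bexp_ln_step (a0 i); exists L.
have [L L0 HL] := ln_step A0.
have [B B0 HB] := binomial_risk_bound.
have sK0 : 0 <= \sum_i K i by apply: sumr_ge0 => i _; have [] := HK i.
exists (32 * (L + \sum_i K i)); first by rewrite mulr_ge0// addr_ge0.
move=> th e N e0 eth th1 Ne.
have th0 i : 0 < th i by exact: lt_le_trans (eth i).
have thle1 i : th i <= 1.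
  by rewrite -th1 (bigD1 i)//= lerDl sumr_ge0// => j _; exact: ltW.
have th01 i : 0 < th i <= 1 by rewrite th0 thle1.
have e1 : e <= 1 by rewrite (le_trans (eth (Ordinal k0))).
have N0 : (0 < N)%N by case: N Ne => //; rewrite mul0r ler10.
have nth n i : (N <= n)%N -> 1 <= n%:R * th i.
  move=> Nn; apply: (le_trans Ne); apply: ler_pM => //; first exact: ltW.
  by rewrite ler_nat.
have [B' HB'] := risk_main_bound th.
pose u n := binomial_risk th n - risk_main th n.
have -> : 32 * (L + \sum_i K i) * (N%:R ^- 5 * e ^- 4) =
  32 * ((L + \sum_i K i) * e ^- 4) * N%:R ^- 5 by ring.
(* Lets the remainder of [ln (n + A)], which is free of [th], share the factor [e ^- 4]. *)
have e4 : 1 <= e ^- 4.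
  rewrite -[1 in leLHS]invr1 lef_pV2 ?posrE ?exprn_gt0//.
  by rewrite -(expr1n R 4) lerXn2r ?nnegrE// ltW.
apply: (@telescoping_bound _ u _ (B + B') N N0).
- by rewrite mulr_ge0 ?addr_ge0// invr_ge0 exprn_ge0// ltW.
- move=> n Nn; have n0 : (0 < n)%N by exact: leq_trans Nn.
  have -> : u n.+1 - u n = binomial_risk th n.+1 - binomial_risk th n
      + (risk_main th n - risk_main th n.+1) by rewrite /u; ring.
  rewrite risk_main_step// binomial_risk_step//.
  apply: (le_trans (ler_normB _ _)); rewrite -mulrA mulrDl; apply: lerD.
    apply: (le_trans (HL n)); rewrite ler_wpM2l//.
    apply: (le_trans (inv_rise_le _ n0)).
    by rewrite ler_peMl// invr_ge0 exprn_ge0.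
  rewrite mulr_suml; apply: (le_trans (ler_norm_sum _ _ _)); apply: ler_sum => i _.
  have [Ki0 HKi] := HK i.
  have n0' : 0 < n%:R :> R by rewrite ltr0n.
  rewrite normrM gtr0_norm//.
  apply: (@le_trans _ _ (th i * (K i * (th i * (n%:R * th i) ^- 6)))).
    by rewrite ler_pM2l// HKi// nth.
  have -> : th i * (K i * (th i * (n%:R * th i) ^- 6)) = K i * (th i ^- 4 * n%:R ^- 6).
    by field; rewrite !gt_eqF.
  apply: ler_wpM2l => //; apply: ler_wpM2r; first by rewrite invr_ge0 exprn_ge0// ltW.
  by rewrite lef_pV2 ?posrE ?exprn_gt0// lerXn2r ?nnegrE ?(ltW e0) ?(ltW (th0 i)).
- move=> n Nn; have n0 : (0 < n)%N by exact: leq_trans Nn.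
  rewrite mulrDl; apply: (le_trans (ler_normB _ _)); apply: lerD; last exact: HB'.
  by apply: HB => // i; exact: nth.
Qed.

End binomial_risk.

(** * From inverse rising factorials to powers of the inverse sample size *)

Section power_expansion.
Context {R : realType}.
Local Notation phi := (@inv_rise R).

(** The coefficients are signed Stirling numbers of the second kind, [S(m, r)] in front of [x ^- m]
    for [phi r]. The constant [100] is simply large enough for the four explicit remainders. *)
Lemma inv_rise_expansion (n : nat) : (0 < n)%N -> let x : R := n%:R in
  [/\ `|phi 1 n - (x^-1 - x ^- 2 + x ^- 3 - x ^- 4)| <= 100 * x ^- 5,
      `|phi 2 n - (x ^- 2 - 3 * x ^- 3 + 7 * x ^- 4)| <= 100 * x ^- 5,
      `|phi 3 n - (x ^- 3 - 6 * x ^- 4)| <= 100 * x ^- 5 &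
      `|phi 4 n - x ^- 4| <= 100 * x ^- 5].
Proof.
move=> n0 x; have x1 : 1 <= x by rewrite ler1n.
have x0 : 0 < x by exact: lt_le_trans x1.
rewrite !inv_riseS !inv_rise0 !natrD -/x; clearbody x.
have x1' : 0 < x + 1 by exact: addr_gt0.
have x2' : 0 < x + 2 by exact: addr_gt0.
have x3' : 0 < x + 3 by exact: addr_gt0.
have x4' : 0 < x + 4 by exact: addr_gt0.
have px2 : 0 <= x ^+ 2 by rewrite exprn_ge0// ltW.
have px3 : 0 <= x ^+ 3 by rewrite exprn_ge0// ltW.
have px4 : 0 <= x ^+ 4 by rewrite exprn_ge0// ltW.
have bound (d p q : R) : d = p / (x ^+ 5 * q) -> 0 < q -> `|p| <= 100 * q ->
    `|d| <= 100 * x ^- 5.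
  move=> -> q0 pq; have den0 : 0 < x ^+ 5 * q by rewrite mulr_gt0 ?exprn_gt0.
  rewrite normrM normfV (gtr0_norm den0) ler_pdivrMr// mulrA divfK//.
  by rewrite expf_neq0// gt_eqF.
split.
- apply: (bound _ x (x + 1)) => //; first by field; rewrite !gt_eqF.
  by rewrite gtr0_norm//; lra.
- apply: (bound _ (- (15 * x ^+ 2 + 14 * x)) ((x + 1) * (x + 2))).
  + by field; rewrite !gt_eqF.
  + exact: mulr_gt0.
  + by rewrite normrN ger0_norm; nra.
- apply: (bound _ (25 * x ^+ 3 + 60 * x ^+ 2 + 36 * x) ((x + 1) * (x + 2) * (x + 3))).
  + by field; rewrite !gt_eqF.
  + by rewrite !mulr_gt0.
  + by rewrite ger0_norm; nra.
- apply: (bound _ (- (10 * x ^+ 4 + 35 * x ^+ 3 + 50 * x ^+ 2 + 24 * x))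
    ((x + 1) * (x + 2) * (x + 3) * (x + 4))).
  + by field; rewrite !gt_eqF.
  + by rewrite !mulr_gt0.
  + by rewrite normrN ger0_norm; nra.
Qed.

Context (k : nat) (a : 'I_k -> R).
Local Notation A := (\sum_i a i).

Definition risk_expansion (th : 'I_k -> R) (x : R) : R :=
  (k%:R - 1) / (2 * x)
  + 1 / x ^+ 2 *
    (\sum_(i < k) 1 / (12 * th i) * (6 * a i ^+ 2 - 12 * a i + 5)
     - 1 / 2 * A ^+ 2 + A - 1 / 2 * k%:R + 1 / 12)
  + 1 / x ^+ 3 *
    (\sum_(i < k) 1 / (12 * th i ^+ 2)
       * (- 4 * a i ^+ 3 + 18 * a i ^+ 2 - 24 * a i + 9)
     + \sum_(i < k) 1 / (4 * th i) * (- 6 * a i ^+ 2 + 12 * a i - 5)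
     + 1 / 3 * A ^+ 3 - A + 1 / 2 * k%:R)
  + 1 / x ^+ 4 *
    (\sum_(i < k) 1 / (120 * th i ^+ 3)
       * (30 * a i ^+ 4 - 240 * a i ^+ 3 + 660 * a i ^+ 2 - 720 * a i + 251)
     + \sum_(i < k) 1 / (2 * th i ^+ 2)
       * (4 * a i ^+ 3 - 18 * a i ^+ 2 + 24 * a i - 9)
     + \sum_(i < k) 1 / (12 * th i) * (42 * a i ^+ 2 - 84 * a i + 35)
     - 1 / 4 * A ^+ 4 + A - 1 / 2 * k%:R - 1 / 120).

Lemma risk_expansionE (th : 'I_k -> R) (x : R) : (forall i, 0 < th i) -> 0 < x ->
  risk_expansion th x =
    risk_coef a th 2 * (x^-1 - x ^- 2 + x ^- 3 - x ^- 4)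
    + risk_coef a th 3 / 2 * (x ^- 2 - 3 * x ^- 3 + 7 * x ^- 4)
    + risk_coef a th 4 / 3 * (x ^- 3 - 6 * x ^- 4)
    + risk_coef a th 5 / 4 * x ^- 4.
Proof.
move=> th0 x0; have th0' i : th i != 0 by rewrite gt_eqF.
pose S3 := \sum_i 1 / (12 * th i) * (6 * a i ^+ 2 - 12 * a i + 5).
pose S4 := \sum_i 1 / (12 * th i ^+ 2)
  * (- 4 * a i ^+ 3 + 18 * a i ^+ 2 - 24 * a i + 9).
pose S5 := \sum_i 1 / (120 * th i ^+ 3)
  * (30 * a i ^+ 4 - 240 * a i ^+ 3 + 660 * a i ^+ 2 - 720 * a i + 251).
have E2 : risk_coef a th 2 = (k%:R - 1) / 2.
  rewrite /risk_coef /ln_coef /= (eq_bigr (fun i => 1 / 2 - a i)); last first.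
    by move=> i _; field.
  by rewrite sumrB sumr_const card_ord -mulr_natl; field.
have E3 : risk_coef a th 3 = 2 * S3 - ln_coef A 3.
  by rewrite /risk_coef mulr_sumr; congr (_ - _); apply: eq_bigr => i _;
    rewrite /ln_coef /=; field.
have E4 : risk_coef a th 4 = 3 * S4 - ln_coef A 4.
  by rewrite /risk_coef mulr_sumr; congr (_ - _); apply: eq_bigr => i _;
    rewrite /ln_coef /=; field.
have E5 : risk_coef a th 5 = 4 * S5 - ln_coef A 5.
  by rewrite /risk_coef mulr_sumr; congr (_ - _); apply: eq_bigr => i _;
    rewrite /ln_coef /=; field.
(* The remaining sums repeat [S3] and [S4] up to the Stirling factors [-3], [7] and [-6]. *)
have T3 : \sum_(i < k) 1 / (4 * th i) * (- 6 * a i ^+ 2 + 12 * a i - 5) = - 3 * S3.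
  by rewrite mulr_sumr; apply: eq_bigr => i _; field.
have U3 : \sum_(i < k) 1 / (12 * th i) * (42 * a i ^+ 2 - 84 * a i + 35) = 7 * S3.
  by rewrite mulr_sumr; apply: eq_bigr => i _; field.
have T4 : \sum_(i < k) 1 / (2 * th i ^+ 2)
    * (4 * a i ^+ 3 - 18 * a i ^+ 2 + 24 * a i - 9) = - 6 * S4.
  by rewrite mulr_sumr; apply: eq_bigr => i _; field.
rewrite /risk_expansion E2 E3 E4 E5 T3 U3 T4 -/S3 -/S4 -/S5 /ln_coef /=.
clear E2 E3 E4 E5 T3 U3 T4; move: S3 S4 S5 A => s3 s4 s5 A.
by field; rewrite gt_eqF.
Qed.

Lemma risk_main_expansion : (0 < k)%N -> exists2 C : R, 0 <= C &
  forall (th : 'I_k -> R) (e : R) N, 0 < e ->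
  (forall i, e <= th i) -> (forall i, th i <= 1) -> (0 < N)%N ->
  `|risk_main a th N - risk_expansion th N%:R| <= C * (N%:R ^- 5 * e ^- 4).
Proof.
move=> k0.
pose D r : R := \sum_i `|ln_coef (a i) r| + `|ln_coef A r|.
have D0 r : 0 <= D r by rewrite addr_ge0// sumr_ge0.
exists (100 * (D 2%N + D 3%N + D 4%N + D 5%N)); first by apply: mulr_ge0 => //; do 3 apply: addr_ge0 => //.
move=> th e N e0 eth th1 N0.
have th0 i : 0 < th i by exact: lt_le_trans (eth i).
have e1 : e <= 1 by exact: le_trans (eth (Ordinal k0)) (th1 _).
have e4 : 1 <= e ^- 4.
  rewrite -[1 in leLHS]invr1 lef_pV2 ?posrE ?exprn_gt0//.
  by rewrite -(expr1n R 4) lerXn2r ?nnegrE// ltW.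
(* For [r <= 5] the power of [th i] is at most [th i ^- 3], so this conversion costs no more than
   the factor [e ^- 4] already present. *)
have coef_le r : (r <= 5)%N -> `|risk_coef a th r| <= D r * e ^- 4.
  move=> r5; rewrite mulrDl; apply: (le_trans (ler_normB _ _)); apply: lerD; last first.
    by rewrite ler_peMr.
  rewrite mulr_suml; apply: (le_trans (ler_norm_sum _ _ _)); apply: ler_sum => i _.
  rewrite mulrA normrM mulrC ler_wpM2l// gtr0_norm ?mulr_gt0 ?invr_gt0 ?exprn_gt0//.
  apply: (@le_trans _ _ (th i ^- 3)).
    have -> : th i ^- 3 = th i * th i * th i ^- 5 by field; rewrite gt_eqF.
    rewrite ler_pM2l ?mulr_gt0// lef_pV2 ?posrE ?exprn_gt0//.
    by rewrite ler_wiXn2l// ltW.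
  rewrite lef_pV2 ?posrE ?exprn_gt0//.
  apply: (@le_trans _ _ (e ^+ 3)); first by rewrite ler_wiXn2l// ltW.
  by rewrite lerXn2r ?nnegrE ?(ltW e0) ?(ltW (th0 i)).
have [] := inv_rise_expansion N0; set x : R := N%:R => B1 B2 B3 B4.
have x0 : 0 < x by rewrite ltr0n.
rewrite risk_expansionE// /risk_main.
do 4 rewrite big_nat_recr//=.
rewrite big_geq// add0r divr1.
set E1 := (_ - _ + _ - _) in B1 *; set E2 := (_ - _ + _) in B2 *.
set E3 := (_ - _) in B3 *.
have -> (c2 c3 c4 c5 p1 p2 p3 p4 q1 q2 q3 q4 : R) :
  c2 * p1 + c3 * p2 + c4 * p3 + c5 * p4 - (c2 * q1 + c3 * q2 + c4 * q3 + c5 * q4)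
  = c2 * (p1 - q1) + c3 * (p2 - q2) + c4 * (p3 - q3) + c5 * (p4 - q4) by ring.
have -> : 100 * (D 2%N + D 3%N + D 4%N + D 5%N) * (x ^- 5 * e ^- 4) =
  D 2%N * e ^- 4 * (100 * x ^- 5) + D 3%N * e ^- 4 * (100 * x ^- 5)
  + D 4%N * e ^- 4 * (100 * x ^- 5) + D 5%N * e ^- 4 * (100 * x ^- 5).
  by rewrite /=; ring.
have term r c p b : (r <= 5)%N -> 1 <= c -> `|p| <= b ->
    `|risk_coef a th r / c * p| <= D r * e ^- 4 * b.
  move=> r5 c1 pb; rewrite normrM ler_pM//.
  apply: le_trans (coef_le _ r5).
  rewrite normrM ler_piMr// normfV invf_le1 ger0_norm ?(le_trans _ c1)//.
  exact: lt_le_trans c1.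
rewrite -[risk_coef a th 2]divr1.
do 3 (apply: (le_trans (ler_normD _ _)); apply: lerD; last by apply: term; rewrite ?ler1n).
by apply: term.
Qed.

End power_expansion.

(** * From the multinomial to the binomial distribution *)

Section multinomial.
Context {R : realType} (k : nat).

Definition incr_count n (i : 'I_k) (x : {ffun 'I_k -> 'I_n.+1}) :
  {ffun 'I_k -> 'I_n.+2} := [ffun j => inord (x j + (j == i))].

Definition decr_count n (i : 'I_k) (x : {ffun 'I_k -> 'I_n.+2}) :
  {ffun 'I_k -> 'I_n.+1} := [ffun j => inord (x j - (j == i))].

Lemma incr_countE n i (x : {ffun 'I_k -> 'I_n.+1}) j :
  incr_count i x j = (x j + (j == i))%N :> nat.
Proof.
rewrite ffunE inordK//.
by have := ltn_ord (x j); case: (j == i) => /= h; lia.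
Qed.

Lemma sum_incr_count n i (x : {ffun 'I_k -> 'I_n.+1}) :
  (\sum_j incr_count i x j = (\sum_j x j).+1)%N.
Proof.
under eq_bigr do rewrite incr_countE.
rewrite big_split /= -[RHS]addn1; congr (_ + _)%N.
by rewrite (bigD1 i)//= eqxx big1 ?addn0// => j /negbTE->.
Qed.

Lemma incr_countK n i : cancel (@incr_count n i) (decr_count i).
Proof.
move=> x; apply/ffunP => j; apply/ord_inj.
by rewrite ffunE incr_countE addnK inord_val.
Qed.

(** An entry other than [i] equal to [n.+1] would be out of range for [inord]; a positive entry at
    [i] and the total [n.+1] exclude it. *)
Lemma decr_countK n i (x : {ffun 'I_k -> 'I_n.+2}) :
  x \in counts k n.+1 -> (0 < x i)%N -> incr_count i (decr_count i x) = x.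
Proof.
rewrite inE => /eqP xn xi; apply/ffunP => j; apply/ord_inj.
have xjn : (x j - (j == i) < n.+1)%N.
  case: eqVneq => [->|ji]; first by have := ltn_ord (x i); lia.
  have : (x i + x j <= \sum_l x l)%N.
    by rewrite (bigD1 i)//= (bigD1 j)//= addnA leq_addr.
  by rewrite xn subn0; lia.
rewrite incr_countE ffunE inordK//.
by case: eqVneq => [->|ji]; rewrite ?subnK// subn0 addn0.
Qed.

Variable th : 'I_k -> R.

Lemma multinomial_pmf_incr n i (x : {ffun 'I_k -> 'I_n.+1}) :
  (incr_count i x i)%:R / n.+1%:R * multinomial_pmf th (incr_count i x)
  = th i * multinomial_pmf th x.
Proof.
rewrite /multinomial_pmf incr_countE eqxx addn1.
have -> : (\prod_j (incr_count i x j)`! = (x i).+1 * \prod_j (x j)`!)%N.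
  rewrite (bigD1 i)//= [in RHS](bigD1 i)//= incr_countE eqxx addn1 factS mulnA.
  congr (_ * _)%N; apply: eq_bigr => j /negbTE ji.
  by rewrite incr_countE ji addn0.
have -> : \prod_j th j ^+ incr_count i x j = th i * \prod_j th j ^+ x j.
  rewrite (bigD1 i)//= [in RHS](bigD1 i)//= incr_countE eqxx addn1 exprS mulrA.
  congr (_ * _); apply: eq_bigr => j /negbTE ji.
  by rewrite incr_countE ji addn0.
have f0 : (\prod_j (x j)`!)%:R != 0 :> R.
  by rewrite pnatr_eq0 -lt0n prodn_gt0// => j; exact: fact_gt0.
have n0 : n.+1%:R != 0 :> R by [].
have m0 : (x i).+1%:R != 0 :> R by [].
rewrite factS !natrM; move: f0 n0 m0.
move: (\prod_j (x j)`!)%:R (n.+1)%:R (x i).+1%:R => u v w u0 v0 w0.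
by field; rewrite u0 v0 w0.
Qed.

(** Insert the weights [x i / n.+1], which add up to [1], discard the terms with [x i = 0] and
    reindex the others by [incr_count i]: this conditions on the category of one observation. *)
Lemma multinomial_expectation_step n (F : {ffun 'I_k -> 'I_n.+2} -> R) :
  \sum_(x in counts k n.+1) multinomial_pmf th x * F x =
  \sum_i th i * \sum_(x in counts k n) multinomial_pmf th x * F (incr_count i x).
Proof.
transitivity (\sum_i \sum_(x in counts k n.+1)
    (x i)%:R / n.+1%:R * multinomial_pmf th x * F x).
  rewrite exchange_big; apply: eq_bigr => x; rewrite inE => /eqP xn.
  by rewrite -!mulr_suml -natr_sum xn divff// mul1r.
apply: eq_bigr => i _.
rewrite (bigID (fun x : {ffun 'I_k -> 'I_n.+2} => (0 < x i)%N))/= addrC big1 => [|x]; last first.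
  by rewrite lt0n negbK => /andP[_ /eqP->]; rewrite !mul0r.
rewrite add0r (reindex_onto (@incr_count n i) (decr_count i)) => [|x /andP[xn xi]]; last first.
  exact: decr_countK.
rewrite mulr_sumr; apply: eq_big => [x|x _].
  by rewrite incr_countK eqxx andbT !inE sum_incr_count eqSS incr_countE eqxx addn1 andbT.
by rewrite multinomial_pmf_incr mulrA.
Qed.

Lemma multinomial_expectation0 (F : {ffun 'I_k -> 'I_1} -> R) :
  \sum_(x in counts k 0) multinomial_pmf th x * F x = F [ffun=> ord0].
Proof.
rewrite (bigD1 [ffun=> ord0])/=; last first.
  by rewrite inE big1// => i _; rewrite ffunE.
rewrite big1 ?addr0 => [|x /andP[_ /eqP x0]]; last first.
  by exfalso; apply: x0; apply/ffunP => i; rewrite ffunE [x i]ord1.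
rewrite /multinomial_pmf fact0 big1 => [|i _]; last by rewrite ffunE.
by rewrite big1 => [|i _]; rewrite ?ffunE ?expr0// divr1 !mul1r.
Qed.

(** Seen from category [i], the other categories act as a single failure of probability [1 - th i],
    which is the recursion of [bexp]. *)
Lemma multinomial_marginal n i (f : nat -> R) : \sum_j th j = 1 ->
  \sum_(x in counts k n) multinomial_pmf th x * f (x i) = bexp (th i) n f.
Proof.
move=> th1; elim: n f => [|n IHn] f.
  by rewrite (multinomial_expectation0 (fun x => f (x i))) ffunE.
rewrite (multinomial_expectation_step (fun x => f (x i))) (bigD1 i)//=.
congr (_ * _ + _).
  rewrite -IHn; apply: eq_bigr => x _.
  by rewrite incr_countE eqxx addn1.
transitivity (\sum_(j | j != i) th j * bexp (th i) n f).
  apply: eq_bigr => j ji; congr (_ * _); rewrite -IHn; apply: eq_bigr => x _.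
  by rewrite incr_countE eq_sym (negbTE ji) addn0.
by rewrite -mulr_suml -th1 [in RHS](bigD1 i)//= addrAC subrr add0r.
Qed.

Definition unit_count (i : 'I_k) : {ffun 'I_k -> 'I_2} :=
  incr_count i [ffun=> ord0].

Lemma unit_countE i j : unit_count i j = (j == i) :> nat.
Proof. by rewrite incr_countE ffunE. Qed.

Lemma obs_pmf_unit i : obs_pmf th (unit_count i) = th i.
Proof.
rewrite /obs_pmf (bigD1 i)//= big1 => [|j /negbTE ji].
  by rewrite unit_countE eqxx mulr1.
by rewrite unit_countE ji.
Qed.

Lemma obs_expectation (F : {ffun 'I_k -> 'I_2} -> R) :
  \sum_(y in counts k 1) obs_pmf th y * F y = \sum_i th i * F (unit_count i).
Proof.
transitivity (\sum_(y in counts k 1) multinomial_pmf th y * F y).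
  apply: eq_bigr => y _; congr (_ * _).
  rewrite /multinomial_pmf big1 ?divr1 ?mul1r// => i _.
  by case: (y i) => -[|[|]].
rewrite multinomial_expectation_step; apply: eq_bigr => i _.
by rewrite multinomial_expectation0.
Qed.

(** Once [y] is the [i]-th unit vector, the logarithm involves [x] only through [x i], so only
    binomial marginals enter. *)
Lemma kl_riskE n (a : 'I_k -> R)
    (q : {ffun 'I_k -> 'I_2} -> {ffun 'I_k -> 'I_n.+1} -> R) :
  (forall i, 0 < a i) -> (forall i, 0 < th i) -> \sum_i th i = 1 ->
  (forall i x, x \in counts k n ->
    q (unit_count i) x = ((x i)%:R + a i) / (n%:R + \sum_j a j)) ->
  kl_risk th q = binomial_risk a th n.
Proof.
move=> a0 th0 th1 qE.
transitivity (\sum_(y in counts k 1) obs_pmf th y * \sum_(x in counts k n)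
    multinomial_pmf th x * ln (obs_pmf th y / q y x)).
  by apply: eq_bigr => y _; rewrite mulr_sumr; apply: eq_bigr => x _; ring.
rewrite obs_expectation; apply: eq_bigr => i _; congr (_ * _).
rewrite obs_pmf_unit.
have A0 : 0 < n%:R + \sum_j a j.
  rewrite ltr_wpDl// (bigD1 i)//= ltr_pwDl// sumr_ge0// => j _; exact: ltW.
rewrite -[X in X - _](bexp_cst (th i) _ n) -bexpB -(multinomial_marginal _ _ _ th1).
apply: eq_bigr => x xn; congr (_ * _); rewrite qE// invf_div mulrA ln_div ?lnM ?posrE//.
- exact: mulr_gt0.
- by rewrite ltr_wpDl.
Qed.

End multinomial.

(** * Beta integrals *)

Section affine_substitution.
Context {R : realType}.
Local Notation mu := (@lebesgue_measure R).
Local Open Scope ereal_scope.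

(** The image of [mu] under the affine map, scaled by [c], gives half-open intervals their length
    and is therefore [mu]. *)
Lemma ge0_integral_affine (f : R -> \bar R) (c d : R) : (0 < c)%R ->
  measurable_fun [set: R] f -> (forall x, 0 <= f x) ->
  \int[mu]_x f x = c%:E * \int[mu]_x f (c * x + d)%R.
Proof.
move=> c0 mf f0.
pose phi : measurableTypeR R -> measurableTypeR R := fun x => (c * x + d)%R.
have mphi : measurable_fun [set: measurableTypeR R] phi.
  have : measurable_fun [set: R] (fun x : R => c * x + d)%R.
    by apply: measurable_funD => //; exact: measurable_funM.
  exact.
have c0' : (0 <= c)%R by exact: ltW.
pose pf : {measure set (measurableTypeR R) -> \bar R} :=
  measure_function_pushforward__canonical__measure_function_Measure mu mphi.
pose nu := mscale (NngNum c0') pf.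
have nuE A : measurable A -> mu A = nu A.
  apply: (lebesgue_measure_unique (mu := nu)) => _ [[a b]] _ <-.
  transitivity (c%:E * mu (phi @^-1` [set` `]a, b]%R])); last by [].
  have -> : phi @^-1` [set` `]a, b]] = [set` `](a - d) / c, (b - d) / c]]%R.
    apply/seteqP; split => x /=; rewrite !in_itv/= /phi.
      by rewrite ltr_pdivrMr// ler_pdivlMr// (mulrC x) ltrBlDr lerBrDr.
    by rewrite ltr_pdivrMr// ler_pdivlMr// (mulrC x) ltrBlDr lerBrDr.
  rewrite !lebesgue_measure_itv/= !lte_fin ltr_pM2r ?invr_gt0// ltrD2r.
  case: ifPn => _; last by rewrite mule0.
  by rewrite -!EFinB -EFinM; congr EFin; field; rewrite gt_eqF.
rewrite (eq_measure_integral nu) => [|A mA _]; last exact: nuE.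
rewrite ge0_integral_mscale//; congr (_ * _).
by rewrite ge0_integral_pushforward.
Qed.

End affine_substitution.

Section beta_integral.
Context {R : realType}.
Local Notation mu := (@lebesgue_measure R).

(** Power of the positive part, [0] at [t = 0] whatever [p]. The shift of the exponent makes
    parameters add under convolution, and vanishing off the half-line lets integrals run over the
    whole line. *)
Definition ppow (p t : R) : R := if 0 < t then t `^ (p - 1) else 0.

Lemma ppow_ge0 p t : 0 <= ppow p t.
Proof. by rewrite /ppow; case: ifP => // _; exact: powR_ge0. Qed.

Lemma ppow_gt0E p t : 0 < t -> ppow p t = t `^ (p - 1).
Proof. by rewrite /ppow => ->. Qed.

Lemma ppow_le0 p t : t <= 0 -> ppow p t = 0.
Proof. by rewrite /ppow ltNge => ->. Qed.

Lemma measurable_ppow p : measurable_fun [set: R] (ppow p).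
Proof.
by apply: measurable_fun_ifT => //; exact: measurable_fun_ltr.
Qed.

Lemma ppowM p c t : 0 < c -> ppow p (c * t) = c `^ (p - 1) * ppow p t.
Proof.
move=> c0; rewrite /ppow pmulr_rgt0//; case: ifPn => [t0|_]; last by rewrite mulr0.
by rewrite powRM// ltW.
Qed.

Lemma ppowS p t : ppow (p + 1) t = t * ppow p t.
Proof.
rewrite /ppow; case: ifPn => [t0|_]; last by rewrite mulr0.
rewrite addrAC [LHS]powRD; last by rewrite (gt_eqF t0) implybT.
by rewrite powRr1 ?ltW// mulrC.
Qed.

Lemma measurable_ppow_sub q s : measurable_fun [set: R] (fun t => ppow q (s - t)).
Proof.
by apply: measurableT_comp; [exact: measurable_ppow|exact: measurable_funB].
Qed.

Lemma measurable_ppow_conv p q s :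
  measurable_fun [set: R] (fun t => (ppow p t * ppow q (s - t))%:E).
Proof.
apply/measurable_EFinP; apply: measurable_funM; first exact: measurable_ppow.
exact: measurable_ppow_sub.
Qed.

Definition beta_integral (p q : R) : \bar R :=
  (\int[mu]_t (ppow p t * ppow q (1 - t))%:E)%E.

(** For [s <= 0] the supports do not meet. For [s > 0] the substitution [t = s u] extracts [s] to
    the power [1 + (p - 1) + (q - 1)]. *)
Lemma ppow_conv p q s : (\int[mu]_t (ppow p t * ppow q (s - t))%:E)%E =
  ((ppow (p + q) s)%:E * beta_integral p q)%E.
Proof.
have pq0 t s' : 0 <= ppow p t * ppow q (s' - t) by rewrite mulr_ge0 ?ppow_ge0.
have [s0|s0] := leP s 0.
  rewrite (ppow_le0 _ s0) mul0e; apply: integral0_eq => t _.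
  have [t0|t0] := leP t 0; first by rewrite (ppow_le0 _ t0) mul0r.
  by rewrite [ppow q _]ppow_le0 ?mulr0// subr_le0 ltW// (le_lt_trans s0).
rewrite (ge0_integral_affine 0 s0 (measurable_ppow_conv p q s)); last first.
  by move=> x; rewrite lee_fin.
under eq_integral => t _.
  rewrite addr0 -[X in X - s * t]mulr1 -mulrBr !ppowM// mulrACA EFinM.
  over.
rewrite ge0_integralZl_EFin//; last 3 first.
- by move=> x _; rewrite lee_fin.
- exact: measurable_ppow_conv.
- by rewrite mulr_ge0 ?powR_ge0.
rewrite muleA -EFinM; congr (_%:E * _)%E.
rewrite (ppow_gt0E _ s0) -{1}[s]powRr1 ?ltW// -!powRD ?(gt_eqF s0) ?implybT//.
by congr (_ `^ _); ring.
Qed.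

End beta_integral.

Section beta_values.
Context {R : realType}.
Local Notation mu := (@lebesgue_measure R).

Lemma powR_ftc (p e : R) : p != 0 -> 0 < e < 1 ->
  (\int[mu]_(t in `[e, 1%R]) (t `^ (p - 1))%:E = (p^-1 - e `^ p / p)%:E)%E.
Proof.
move=> p0 /andP[e0 e1].
have drv (x : R) : 0 < x -> is_derive x 1 (fun t => p^-1 * t `^ p) (x `^ (p - 1)).
  move=> x0; have ? := is_derive1_powR p x0.
  by apply: is_derive_eq; rewrite /GRing.scale/= mulrA mulVf// mul1r.
have cont (r x : R) : 0 < x -> {for x, continuous (fun t : R => t `^ r)}.
  move=> x0; apply/differentiable_continuous/derivable1_diffP.
  by apply: derivable_powR; rewrite in_itv/= x0.
have cF (x : R) : 0 < x -> {for x, continuous (fun t => p^-1 * t `^ p)}.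
  by move=> x0; apply: continuousM; [exact: cst_continuous|exact: cont].
rewrite (@continuous_FTC2 _ _ (fun t => p^-1 * t `^ p))//.
- by rewrite powR1 mulr1 mulrC.
- apply: continuous_in_subspaceT => x; rewrite inE/= in_itv/= => /andP[ex _].
  by apply: cont; exact: lt_le_trans ex.
- split.
  + move=> x; rewrite in_itv/= => /andP[ex _].
    by have [] := drv x (lt_trans e0 ex).
  + exact/cvg_at_right_filter/cF.
  + exact/cvg_at_left_filter/cF.
- move=> x; rewrite in_itv/= => /andP[ex _].
  by have [_] := drv x (lt_trans e0 ex); rewrite derive1E.
Qed.

(** [ppow 1] is the indicator of the positive half-line, so this integrates a power over the unit
    interval, possibly improperly at [0]; monotone convergence handles that end. *)
Lemma beta_integral1 (p : R) : 0 < p -> beta_integral p 1 = p^-1%:E.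
Proof.
move=> p0.
(* [n.+2] keeps the left end strictly below [1], as [powR_ftc] requires. *)
pose F (n : nat) := `[n.+2%:R^-1, 1%R]%classic : set R.
have n1 n : 0 < (n.+2%:R : R)^-1 < 1 by rewrite invr_gt0 ltr0n/= invf_lt1 ?ltr0n// ltr1n.
have UF : \bigcup_n F n = `]0%R, 1%R]%classic.
  apply/seteqP; split => x /=.
    move=> [n _]; rewrite /F/= !in_itv/= => /andP[nx ->]; rewrite andbT.
    by apply: lt_le_trans nx; have /andP[] := n1 n.
  rewrite in_itv/= => /andP[x0 x1].
  exists (Num.bound x^-1) => //; rewrite /F/= in_itv/= x1 andbT.
  rewrite -[leRHS]invrK lef_pV2 ?posrE ?invr_gt0 ?ltr0n//.
  rewrite (le_trans (ltW (archi_boundP _))) ?invr_ge0 ?(ltW x0)//.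
  by rewrite ler_nat -addn2 leq_addr.
have -> : beta_integral p 1 = (\int[mu]_(t in `]0%R, 1%R]) (t `^ (p - 1))%:E)%E.
  rewrite -integral_itv_bndo_bndc; last first.
    by apply/measurable_EFinP; exact: measurable_funTS.
  rewrite [RHS]integral_mkcond; apply: eq_integral => t _.
  rewrite patchE; case: ifPn => [|].
    rewrite inE/= in_itv/= => /andP[t0 t1].
    by rewrite !ppow_gt0E ?subr_gt0// subrr powRr0 mulr1.
  rewrite notin_setE/= in_itv/= => /negP; rewrite negb_and -!leNgt => /orP[t0|t1].
    by rewrite ppow_le0// mul0r.
  by rewrite [X in _ * X]ppow_le0 ?mulr0// subr_le0.
have cvgI : (\int[mu]_(t in F n) (t `^ (p - 1))%:E @[n --> \oo]
   --> \int[mu]_(t in `]0%R, 1%R]) (t `^ (p - 1))%:E)%E.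
  rewrite -UF; apply: ge0_nondecreasing_set_cvg_integral.
  - apply/nondecreasing_seqP => n; rewrite subsetEset; apply: subset_itvr.
    by rewrite bnd_simp lef_pV2 ?posrE ?ltr0n// ler_nat.
  - by move=> i; exact: measurable_itv.
  - by move=> i; apply/measurable_EFinP; exact: measurable_funTS.
  - by move=> i x _; rewrite lee_fin powR_ge0.
have cvgV : ((p^-1 - n.+2%:R^-1 `^ p / p)%:E @[n --> \oo] --> p^-1%:E)%E.
  apply: cvg_EFin; first by apply: nearW.
  rewrite -[X in _ --> X]subr0 -(mul0r p^-1); apply: cvgB; first exact: cvg_cst.
  apply: cvgM; last exact: cvg_cst.
  have /cvg_at_rightP := powR_cvg0 p0; apply; split.
    by move=> n; have /andP[] := n1 n.
  have := @cvg_harmonic R; rewrite -(cvg_shiftS (@harmonic R)); exact.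
apply: (cvg_unique _ cvgI) => //=.
rewrite (_ : (fun n => _) = (fun n => (p^-1 - n.+2%:R^-1 `^ p / p)%:E)%E)//.
by apply/funext => n; rewrite powR_ftc// gt_eqF.
Qed.

End beta_values.

Section beta_recursion.
Context {R : realType}.
Local Notation mu := (@lebesgue_measure R).

Lemma beta_integral_ge0 (p q : R) : (0 <= beta_integral p q)%E.
Proof. by apply: integral_ge0 => t _; rewrite lee_fin mulr_ge0 ?ppow_ge0. Qed.

(** Convolution with [ppow 1] is integration: this is [ppow_conv] after a shift, with
    [B q 1 = 1 / q]. *)
Lemma ppow_primitive (q s t : R) : 0 < q ->
  (\int[mu]_w (ppow q (w - t) * ppow 1 (s - w))%:E = (ppow (q + 1) (s - t) / q)%:E)%E.
Proof.
move=> q0.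
have mf : measurable_fun [set: R] (fun w => (ppow q (w - t) * ppow 1 (s - w))%:E).
  apply/measurable_EFinP; apply: measurable_funM; last exact: measurable_ppow_sub.
  by apply: measurableT_comp; [exact: measurable_ppow|exact: measurable_funB].
rewrite (ge0_integral_affine t ltr01 mf); last first.
  by move=> x; rewrite lee_fin mulr_ge0 ?ppow_ge0.
rewrite mul1e.
under eq_integral => x _ do rewrite mul1r addrK opprD addrCA addrC.
by rewrite ppow_conv beta_integral1.
Qed.

(* Both sides are values of the convolution of [ppow p], [ppow q] and [ppow 1]
   at [1], associated differently. *)
Lemma beta_integralS (p q : R) : 0 < p -> 0 < q ->
  beta_integral p (q + 1) = ((q / (p + q))%:E * beta_integral p q)%E.
Proof.
move=> p0 q0.
have qK (B : \bar R) : B = (q%:E * (q^-1%:E * B))%E.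
  by rewrite muleA -EFinM divff ?gt_eqF// mul1e.
pose f (z : measurableTypeR R * measurableTypeR R) : \bar R :=
  (ppow p z.1 * (ppow q (z.2 - z.1) * ppow 1 (1 - z.2)))%:E.
have f0 z : (0 <= f z)%E by rewrite lee_fin !mulr_ge0 ?ppow_ge0.
have mf : measurable_fun setT f.
  apply/measurable_EFinP; apply: measurable_funM.
    exact: (measurableT_comp (measurable_ppow p) measurable_fst).
  apply: measurable_funM.
    apply: (measurableT_comp (measurable_ppow q)).
    exact: (measurable_funB measurable_snd measurable_fst).
  exact: (measurableT_comp (measurable_ppow_sub 1 1) measurable_snd).
have E := @fubini_tonelli _ _ _ _ R mu mu f mf f0.
have mw t : measurable_fun [set: R] (fun w => (ppow q (w - t) * ppow 1 (1 - w))%:E).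
  apply/measurable_EFinP; apply: measurable_funM; last exact: measurable_ppow_sub.
  by apply: measurableT_comp; [exact: measurable_ppow|exact: measurable_funB].
have pp0 (r r' t t' : R) : (0 <= (ppow r t * ppow r' t')%:E)%E.
  by rewrite lee_fin mulr_ge0 ?ppow_ge0.
have scale (c : R) (g : R -> \bar R) : 0 <= c -> measurable_fun [set: R] g ->
    (forall x, 0 <= g x)%E -> (\int[mu]_x (c%:E * g x) = c%:E * \int[mu]_x g x)%E.
  by move=> c0 mg g0; rewrite ge0_integralZl_EFin.
(* Integrating [w] out first produces [B p (q + 1) / q]; integrating [t] out first produces
   [B p q / (p + q)]. *)
have lhsE : (\int[mu]_t \int[mu]_w f (t, w) = q^-1%:E * beta_integral p (q + 1))%E.
  transitivity (\int[mu]_t (q^-1%:E * (ppow p t * ppow (q + 1) (1 - t))%:E))%E.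
    apply: eq_integral => t _.
    transitivity (\int[mu]_w ((ppow p t)%:E * (ppow q (w - t) * ppow 1 (1 - w))%:E))%E.
      by apply: eq_integral => w _.
    transitivity ((ppow p t)%:E * (ppow (q + 1) (1 - t) / q)%:E)%E.
      rewrite -(ppow_primitive 1 t q0).
      exact: (scale _ _ (ppow_ge0 p t) (mw t) (fun w => pp0 _ _ _ _)).
    by rewrite -!EFinM; congr EFin; ring.
  have q0' : 0 <= q^-1 by rewrite invr_ge0 ltW.
  exact: (scale _ _ q0' (measurable_ppow_conv p (q + 1) 1) (fun t => pp0 _ _ _ _)).
have rhsE : (\int[mu]_w \int[mu]_t f (t, w) =
    beta_integral p q * beta_integral (p + q) 1)%E.
  transitivity (\int[mu]_w (beta_integral p q * (ppow (p + q) w * ppow 1 (1 - w))%:E))%E.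
    apply: eq_integral => w _.
    transitivity (\int[mu]_t ((ppow 1 (1 - w))%:E * (ppow p t * ppow q (w - t))%:E))%E.
      by apply: eq_integral => t _; rewrite -EFinM /f/=; congr EFin; ring.
    transitivity ((ppow 1 (1 - w))%:E * ((ppow (p + q) w)%:E * beta_integral p q))%E.
      rewrite -ppow_conv.
      exact: (scale _ _ (ppow_ge0 1 (1 - w)) (measurable_ppow_conv p q w)
        (fun w => pp0 _ _ _ _)).
    by rewrite muleA -EFinM mulrC muleC.
  exact: (@ge0_integralZl _ _ R mu _ measurableT _ (measurable_ppow_conv (p + q) 1 1)
    (beta_integral p q) (fun w _ => pp0 _ _ _ _) (beta_integral_ge0 p q)).
rewrite [LHS]qK -lhsE E rhsE (beta_integral1 (addr_gt0 p0 q0)).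
clear E lhsE rhsE f0 mf f; move: (beta_integral p q) => B.
by rewrite muleCA muleC -EFinM.
Qed.

(** The integrand may be singular at [1]. Raising [q] by one removes this, as
    [B p (q + 1) <= B p 1], and the recursion brings finiteness back to [q]. *)
Lemma beta_integral_lty (p q : R) : 0 < p -> 0 < q -> (beta_integral p q < +oo)%E.
Proof.
move=> p0 q0.
have : (beta_integral p (q + 1) < +oo)%E.
  apply: (@le_lt_trans _ _ (beta_integral p 1)); last by rewrite beta_integral1// ltry.
  apply: ge0_le_integral => //.
  - by move=> t _; rewrite lee_fin mulr_ge0 ?ppow_ge0.
  - exact: measurable_ppow_conv.
  - exact: measurable_ppow_conv.
  - move=> t _; rewrite lee_fin.
    have [t0|t0] := leP t 0; first by rewrite (ppow_le0 p t0) !mul0r.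
    rewrite ler_wpM2l ?ppow_ge0//.
    have [t1|t1] := leP 1 t; first by rewrite !ppow_le0 ?subr_le0.
    rewrite !ppow_gt0E ?subr_gt0// addrK subrr powRr0.
    rewrite -[X in _ <= X](powRr0 (1 - t)) ger_powR ?(ltW q0)//.
    by rewrite subr_gt0 t1 gerBl ltW.
rewrite beta_integralS//.
case: (beta_integral p q) => [r| |]; rewrite ?ltry//.
by rewrite gt0_muley ?lte_fin ?divr_gt0 ?addr_gt0.
Qed.

Lemma beta_integral_gt0 (p q : R) : 0 < p -> 0 < q -> (0 < beta_integral p q)%E.
Proof.
move=> p0 q0; pose c : R := 4^-1 `^ p * 4^-1 `^ q.
have c0 : 0 < c by rewrite mulr_gt0 ?powR_gt0 ?invr_gt0.
(* Passing through [t ^ r <= t ^ (r - 1)] avoids a case distinction on the sign of [r - 1]. *)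
have pow (r t : R) : 0 < r -> 4^-1 <= t < 1 -> 4^-1 `^ r <= ppow r t.
  move=> r0 /andP[t4 t1]; have t0 : 0 < t by apply: lt_le_trans t4; rewrite invr_gt0.
  rewrite ppow_gt0E//; apply: (@le_trans _ _ (t `^ r)).
    by rewrite ge0_ler_powR ?nnegrE ?(ltW r0) ?(ltW t0)// invr_ge0.
  by rewrite ger_powR ?t0 ?(ltW t1)// gerBl.
apply: (@lt_le_trans _ _ (\int[mu]_(t in `[4^-1%R, 2^-1%R]) c%:E)%E).
  rewrite integral_cst//= lebesgue_measure_itv/= lte_fin.
  rewrite ifT; last by rewrite ltf_pV2 ?posrE// ltr_nat.
  by rewrite -EFinB -EFinM lte_fin mulr_gt0// subr_gt0 ltf_pV2 ?posrE// ltr_nat.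
rewrite integral_mkcond; apply: ge0_le_integral => //.
- by move=> t _; apply: erestrict_ge0 => x _; rewrite lee_fin ltW.
- by apply/(measurable_restrictT _ _).1 => //; exact: measurable_cst.
- exact: measurable_ppow_conv.
move=> t _; rewrite patchE; case: ifPn => [|_]; last first.
  by rewrite lee_fin mulr_ge0 ?ppow_ge0.
rewrite inE/= in_itv/= => /andP[t4 t2]; rewrite lee_fin.
have h4 : 4^-1 + 4^-1 = 2^-1 :> R by field.
have h2 : 2^-1 + 2^-1 = 1 :> R by field.
have h0 : 0 < 4^-1 :> R by rewrite invr_gt0.
by apply: ler_pM; rewrite ?powR_ge0//; apply: pow => //; lra.
Qed.

End beta_recursion.

(** * Dirichlet integrals *)

Section simplex_integral.
Context {R : realType}.
Local Notation mu := (@lebesgue_measure R).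

(** Serves to discard [t = 0], where the integrand need not agree with [ppow], and [t = s], where no
    mass is left for the remaining coordinates. *)
Lemma eq_integral_except2 (x y : R) (f h : R -> \bar R) :
  measurable_fun [set: R] h -> (forall t, t != x -> t != y -> f t = h t) ->
  (\int[mu]_t f t = \int[mu]_t h t)%E.
Proof.
move=> mh fh.
have fE : f = fun t => if t == x then f x else if t == y then f y else h t.
  apply/funext => t; case: eqVneq => [->//|tx]; case: eqVneq => [->//|ty].
  exact: fh.
have mf : measurable_fun [set: R] f.
  rewrite fE; apply: measurable_fun_ifT => //.
    by apply: measurable_fun_eqr.
  by apply: measurable_fun_ifT => //; exact: measurable_fun_eqr.
apply: ae_eq_integral => //.
exists ([set x] `|` [set y]); split.
- exact: measurableU.
- by apply: null_set_setU => //; exact: lebesgue_measure_set1.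
- move=> t /= /not_implyP[_ ft]; apply: contrapT => /not_orP[tx ty].
  by apply: ft; apply: fh; apply/eqP.
Qed.

Definition euler_beta (p q : R) : R := fine (beta_integral p q).

Lemma euler_betaE p q : 0 < p -> 0 < q -> beta_integral p q = (euler_beta p q)%:E.
Proof.
move=> p0 q0; rewrite /euler_beta fineK// ge0_fin_numE ?beta_integral_ge0//.
exact: beta_integral_lty.
Qed.

Lemma euler_beta_gt0 p q : 0 < p -> 0 < q -> 0 < euler_beta p q.
Proof. by move=> p0 q0; rewrite -lte_fin -euler_betaE// beta_integral_gt0. Qed.

Lemma euler_betaSr p q : 0 < p -> 0 < q ->
  euler_beta p (q + 1) = q / (p + q) * euler_beta p q.
Proof.
move=> p0 q0; apply: EFin_inj; rewrite EFinM -!euler_betaE ?addr_gt0//.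
exact: beta_integralS.
Qed.

(** As [t + (1 - t) = 1], the two raised integrals add up to [B p q], and [euler_betaSr] gives one
    of them. *)
Lemma euler_betaSl p q : 0 < p -> 0 < q ->
  euler_beta (p + 1) q = p / (p + q) * euler_beta p q.
Proof.
move=> p0 q0.
suff E : euler_beta (p + 1) q + euler_beta p (q + 1) = euler_beta p q.
  apply: (addIr (euler_beta p (q + 1))); rewrite E euler_betaSr// -mulrDl -mulrDl.
  by rewrite divff ?mul1r// gt_eqF// addr_gt0.
apply: EFin_inj; rewrite EFinD -!euler_betaE ?addr_gt0// /beta_integral.
rewrite -ge0_integralD//.
- apply: eq_integral => t _; rewrite -EFinD !ppowS; congr EFin; ring.
- by move=> t _; rewrite lee_fin mulr_ge0 ?ppow_ge0.
- exact: measurable_ppow_conv.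
- by move=> t _; rewrite lee_fin mulr_ge0 ?ppow_ge0.
- exact: measurable_ppow_conv.
Qed.

(* Integrating out the first of [n + 1] coordinates leaves a Dirichlet integral
   over the others, on a simplex of smaller size. *)
Fixpoint dirichlet_const (b : nat -> R) (n : nat) : R :=
  if n is n'.+1 then
    euler_beta (b 0%N) (\sum_(i < n) b i.+1) * dirichlet_const (fun i => b i.+1) n'
  else 1.

Lemma dirichlet_const_gt0 b n : (forall i, 0 < b i) -> 0 < dirichlet_const b n.
Proof.
elim: n b => //= n IHn b b0; rewrite mulr_gt0 ?IHn// euler_beta_gt0//.
by rewrite big_ord_recl ltr_pwDl// sumr_ge0// => i _; exact: ltW.
Qed.

(** [c] and [s] vary to carry the induction: [c] absorbs the factor of a coordinate already fixed
    and [s] is the mass left for the others. *)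
Lemma integral_simplex_ppow n (g : nat -> R -> R) (b : nat -> R) (c s : R) :
  (forall i, 0 < b i) -> (forall i t, t != 0 -> g i t = ppow (b i) t) ->
  0 <= c -> s != 0 ->
  integral_Rn (fun v : n.-tuple R => (c * (\prod_(i < n) g i (nth 0 v i)
     * g n (s - \sum_(i < n) nth 0 v i)))%:E) =
  (c * dirichlet_const b n * ppow (\sum_(i < n.+1) b i) s)%:E.
Proof.
elim: n g b c s => [|n IHn] g b c s b0 gb c0 s0 /=.
  by rewrite !big_ord0 subr0 mul1r big_ord_recl big_ord0 addr0 mulr1 gb.
set B := \sum_(i < n.+1) b i.+1.
have B0 : 0 < B by rewrite /B big_ord_recl ltr_pwDl// sumr_ge0// => i _; exact: ltW.
set D := dirichlet_const _ n.
have D0 : 0 < D by exact: dirichlet_const_gt0.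
rewrite (@eq_integral_except2 0 s _ (fun t => ((c * D)%:E *
   (ppow (b 0%N) t * ppow B (s - t))%:E)%E)).
- rewrite ge0_integralZl_EFin//.
  + rewrite ppow_conv euler_betaE// -!EFinM; congr EFin.
    rewrite [in RHS]big_ord_recl/= -/B; ring.
  + by move=> t _; rewrite lee_fin mulr_ge0 ?ppow_ge0.
  + exact: measurable_ppow_conv.
  + by rewrite mulr_ge0// ltW.
- by apply: measurable_funeM; exact: measurable_ppow_conv.
move=> t t0 ts; rewrite -EFinM.
transitivity (integral_Rn (fun v : n.-tuple R => (c * ppow (b 0%N) t *
     (\prod_(i < n) g i.+1 (nth 0 v i)
      * g n.+1 ((s - t) - \sum_(i < n) nth 0 v i)))%:E)).
  congr integral_Rn; apply/funext => v; congr EFin.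
  by rewrite !big_ord_recl /= gb// opprD addrA -!mulrA.
rewrite (IHn (fun i => g i.+1) (fun i => b i.+1))//.
- by congr EFin; rewrite -/D -/B; ring.
- by move=> i u u0; exact: gb.
- by rewrite mulr_ge0 ?ppow_ge0.
- by rewrite subr_eq0 eq_sym.
Qed.

End simplex_integral.

Section dirichlet_posterior.
Context {R : realType}.
Local Notation mu := (@lebesgue_measure R).

(** For [i = 0] the left Beta recursion suffices. For [i > 0] the right one gives [B / (b 0 + B)],
    with [B] the sum of the later parameters, and this [B] cancels against the induction hypothesis.
    The resulting ratio is the posterior mean. *)
Lemma dirichlet_constS (b : nat -> R) (n i : nat) : (forall j, 0 < b j) -> (i <= n)%N ->
  dirichlet_const (fun j => b j + (j == i)%:R) n * \sum_(j < n.+1) b j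
  = b i * dirichlet_const b n.
Proof.
elim: n b i => [|n IHn] b i b0 /=.
  by rewrite leqn0 => /eqP->; rewrite big_ord_recl big_ord0 addr0 mul1r mulr1.
pose B := \sum_(j < n.+1) b j.+1.
have B0 : 0 < B.
  by rewrite /B big_ord_recl ltr_pwDl// sumr_ge0// => j _; exact: ltW.
have -> : \sum_(j < n.+2) b j = b 0%N + B by rewrite big_ord_recl.
case: i => [_|i ilen] /=.
  under eq_bigr do rewrite addr0.
  rewrite (_ : (fun j => b j.+1 + _) = (fun j => b j.+1)); last first.
    by apply/funext => j; rewrite addr0.
  rewrite -/B euler_betaSl//; field.
  by rewrite gt_eqF// addr_gt0.
rewrite big_split/= (_ : \sum_(j < n.+1) ((j == i :> nat)%:R : R) = 1); last first.
  rewrite (bigD1 (Ordinal (ilen : i < n.+1)%N))//= eqxx big1 ?addr0// => j ji.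
  by rewrite -val_eqE in ji; rewrite (negbTE ji).
rewrite addr0 -/B euler_betaSr//.
have := IHn (fun j => b j.+1) i (fun j => b0 j.+1) ilen; rewrite -/B.
set D := dirichlet_const (fun _ => _ + _) n; move: D => D E.
rewrite [RHS]mulrCA -E.
by field; rewrite gt_eqF// addr_gt0.
Qed.

Lemma simplex_integral_monomial m (e : 'I_m.+1 -> nat) (a : 'I_m.+1 -> R) (c : R) :
  (forall i, 0 < a i) -> 0 <= c ->
  simplex_integral (fun th => c * \prod_j (th j ^+ e j * th j `^ (a j - 1))) =
  (c * dirichlet_const (fun i => (e (inord i))%:R + a (inord i)) m)%:E.
Proof.
move=> a0 c0.
pose b (i : nat) : R := (e (inord i))%:R + a (inord i).
(* The sign constraints of the simplex go into the factors; the sum constraint holds by construction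
   of [complete_coords]. The factor can be [1] at [t = 0], where [ppow] is [0]. *)
pose g (i : nat) (t : R) : R :=
  t ^+ e (inord i) * t `^ (a (inord i) - 1) * (0 <= t)%R%:R.
have b0 i : 0 < b i by rewrite ltr_wpDl.
have gb i (t : R) : t != 0 -> g i t = ppow (b i) t.
  rewrite /g /ppow; case: ltgtP => // t0 _; last by rewrite mulr0.
  rewrite mulr1 -powR_mulrn ?ltW// -powRD ?addrA// (gt_eqF t0) implybT//.
have := @integral_simplex_ppow R m g b c 1 b0 gb c0 (oner_neq0 _).
rewrite ppow_gt0E// powR1 mulr1 => <-.
rewrite /simplex_integral /=; congr integral_Rn; apply/funext => v; congr EFin.
set th := @complete_coords R m.+1 v.
have thw (i : 'I_m) : th (widen_ord (leqnSn m) i) = nth 0 v i.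
  by rewrite /th /complete_coords /= ltn_ord.
have thm : th ord_max = 1 - \sum_(i < m) nth 0 v i.
  rewrite /th /complete_coords /= ltnn; congr (_ - _).
  by apply: eq_bigr => i _; rewrite (tnth_nth 0).
have th1 : \sum_i th i = 1.
  rewrite big_ord_recr/= thm; under eq_bigr do rewrite thw.
  by rewrite addrC subrK.
have -> : \1_(simplex (k := m.+1)) th = \prod_j (0 <= th j)%R%:R :> R.
  rewrite indicE; have [th0|] := pselect (forall j, 0 <= th j).
    by rewrite mem_set//= big1// => j _; rewrite th0.
  move=> /existsNP[j /negP thj]; rewrite memNset/=; last first.
    by move=> [/(_ j)]; rewrite (negbTE thj).
  by rewrite (bigD1 j)//= (negbTE thj) mul0r.
rewrite -mulrA -big_split/= big_ord_recr/=; congr (_ * (_ * _)).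
  apply: eq_bigr => i _; rewrite /g.
  have -> : inord i = widen_ord (leqnSn m) i.
    by apply/ord_inj; rewrite inordK//= ltnS ltnW.
  by rewrite !thw.
by rewrite thm /g (_ : inord m = ord_max)//; apply/ord_inj; rewrite inordK.
Qed.

End dirichlet_posterior.

(** * Positivity of the Gamma function and the Dirichlet predictive density *)

Section bayes_predictive_dirichlet.
Context {R : realType}.
Local Notation mu := (@lebesgue_measure R).

Let gamma_integrand (a t : R) : R := t `^ (a - 1) * expR (- t).

Let gamma_integrand_ge0 a t : 0 <= gamma_integrand a t.
Proof. by rewrite mulr_ge0 ?powR_ge0 ?expR_ge0. Qed.

Let measurable_gamma_integrand a : measurable_fun [set: R] (gamma_integrand a).
Proof.
apply: measurable_funM => //; apply: measurableT_comp => //.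
Qed.

(** Below [2], [expR (- t) <= 1]. Above, [ln y <= y] at [y = t / (2 * a)] bounds [t ^ a] by
    [(2 * a) ^ a * expR (t / 2)], which leaves half of the decay; the factor [2] undoes the
    normalization of the exponential density. *)
Lemma gamma_integrand_le (a t : R) : 0 < a -> 0 < t -> gamma_integrand a t <=
  ppow a t * ppow 1 (2 - t) + 2 * (2 * a) `^ a * exponential_pdf (1 / 2) t.
Proof.
move=> a0 t0; rewrite /gamma_integrand.
have e0 : 0 <= 2 * (2 * a) `^ a * exponential_pdf (1 / 2) t.
  by rewrite !mulr_ge0 ?powR_ge0// exponential_pdf_ge0// divr_ge0.
have [t2|t2] := ltP t 2.
  rewrite -[leLHS]addr0 lerD// !ppow_gt0E ?subr_gt0// subrr powRr0.
  by rewrite ler_wpM2l ?powR_ge0// -[leRHS]expR0 ler_expR oppr_le0 ltW.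
rewrite [X in _ <= X + _](_ : _ = 0) ?add0r; last first.
  by rewrite [X in _ * X]ppow_le0 ?mulr0// subr_le0.
rewrite exponential_pdfE ?(ltW t0)//.
rewrite (_ : 2 * _ * _ = (2 * a) `^ a * expR (- (1 / 2) * t)); last by field.
have -> : expR (- t) = expR (- (1 / 2) * t) * expR (- (1 / 2) * t).
  by rewrite -expRD; congr expR; field.
rewrite mulrA ler_wpM2r ?expR_ge0//.
apply: (@le_trans _ _ (t `^ a * expR (- (1 / 2) * t))).
  rewrite ler_wpM2r ?expR_ge0// ler_powR ?gerBl//.
  by apply: le_trans t2; rewrite ler1n.
have y0 : 0 < t / (2 * a) by rewrite divr_gt0 ?mulr_gt0.
have -> : t `^ a = (2 * a) `^ a * (t / (2 * a)) `^ a.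
  have a2 : 0 <= 2 * a by rewrite mulr_ge0// ltW.
  rewrite -powRM ?(ltW y0)//.
  by rewrite mulrC divfK// gt_eqF// mulr_gt0.
rewrite -mulrA ler_piMr ?powR_ge0//.
rewrite /powR (gt_eqF y0) -expRD -[leRHS]expR0 ler_expR.
have := ln_sublinear y0 => /ltW h.
have := ler_wpM2l (ltW a0) h.
have -> : a * (t / (2 * a)) = 1 / 2 * t by field; rewrite gt_eqF.
lra.
Qed.

(** Positivity of a [fine] value also requires finiteness. From below, the integrand is at least
    [expR (- 2) / 2] on [[1, 2]]. *)
Lemma Gamma_gt0 (a : R) : 0 < a -> 0 < Gamma a.
Proof.
move=> a0; rewrite /Gamma /Rintegral.
have lt0 : (0 < \int[mu]_(t in `]0%R, +oo[) (gamma_integrand a t)%:E)%E.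
  apply: (@lt_le_trans _ _ (\int[mu]_(t in `[1%R, 2%R]) (2^-1 * expR (- 2))%:E)%E).
    rewrite integral_cst//= lebesgue_measure_itv/= lte_fin ltr1n/=.
    by rewrite -EFinB -EFinM lte_fin !mulr_gt0 ?expR_gt0 ?invr_gt0// subr_gt0 ltr1n.
  apply: (@le_trans _ _ (\int[mu]_(t in `[1%R, 2%R]) (gamma_integrand a t)%:E)%E).
    apply: ge0_le_integral => //.
    - by apply/measurable_EFinP; apply: measurable_funTS; exact: measurable_gamma_integrand.
    - move=> t /=; rewrite in_itv/= => /andP[t1 t2]; rewrite lee_fin.
      have t0 : 0 < t by exact: lt_le_trans t1.
      apply: ler_pM; rewrite ?expR_ge0 ?invr_ge0 ?ler_expR ?lerN2//.
      rewrite powRB ?(gt_eqF t0) ?implybT// powRr1 ?(ltW t0)//.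
      rewrite -[leLHS]mul1r ler_pM ?invr_ge0//; last first.
        by rewrite lef_pV2 ?posrE.
      by rewrite -[leLHS](powRr0 t) ler_powR// ltW.
  apply: ge0_subset_integral => //.
  - by apply/measurable_EFinP; apply: measurable_funTS; exact: measurable_gamma_integrand.
  - by move=> t _; rewrite lee_fin.
  - by move=> t /=; rewrite !in_itv/= andbT => /andP[t1 _]; exact: lt_le_trans t1.
have lty : (\int[mu]_(t in `]0%R, +oo[) (gamma_integrand a t)%:E < +oo)%E.
  pose C : R := 2 * (2 * a) `^ a.
  have C0 : 0 <= C by rewrite mulr_ge0 ?powR_ge0.
  have half0 : 0 < 1 / 2 :> R by rewrite divr_gt0.
  have mexp := @measurable_exponential_pdf R (1 / 2).
  have exp0 t : (0 <= (exponential_pdf (1 / 2) t)%:E :> \bar R)%E.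
    by rewrite lee_fin exponential_pdf_ge0// ltW.
  apply: (@le_lt_trans _ _ (\int[mu]_t ((ppow a t * ppow 1 (2 - t))%:E
      + C%:E * (exponential_pdf (1 / 2) t)%:E))%E).
    rewrite integral_mkcond; apply: ge0_le_integral => //.
    - by move=> t _; apply: erestrict_ge0 => x _; rewrite lee_fin.
    - apply/(measurable_restrictT _ _).1 => //.
      by apply/measurable_EFinP; apply: measurable_funTS; exact: measurable_gamma_integrand.
    - apply: emeasurable_funD; first exact: measurable_ppow_conv.
      by apply: measurable_funeM; exact/measurable_EFinP.
    move=> t _; rewrite patchE; case: ifPn => [|_].
      rewrite inE/= in_itv/= andbT => t0.
      by rewrite -EFinM -EFinD lee_fin gamma_integrand_le.
    apply: adde_ge0; first by rewrite lee_fin mulr_ge0 ?ppow_ge0.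
    by apply: mule_ge0 => //; rewrite lee_fin.
  rewrite ge0_integralD//; last 4 first.
  - by move=> t _; rewrite lee_fin mulr_ge0 ?ppow_ge0.
  - exact: measurable_ppow_conv.
  - by move=> t _; rewrite mule_ge0.
  - by apply: measurable_funeM; exact/measurable_EFinP.
  rewrite ppow_conv euler_betaE// ge0_integralZl_EFin//; last exact/measurable_EFinP.
  by rewrite integral_exponential_pdf// mule1 -EFinM -EFinD ltry.
by rewrite fine_gt0// lt0 lty.
Qed.

Lemma eq_dirichlet_const (b b' : nat -> R) n : (forall j, (j <= n)%N -> b j = b' j) ->
  dirichlet_const b n = dirichlet_const b' n.
Proof.
elim: n b b' => [//|n IHn] b b' bb' /=.
rewrite (bb' 0%N (leq0n _)) (IHn _ (fun j => b' j.+1)) => [|j jn]; last exact: bb'.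
rewrite (eq_bigr (fun j : 'I__ => b' j.+1))// => j _; apply: bb'; exact: ltn_ord.
Qed.

(** Numerator and denominator are Dirichlet integrals with the same factor [c], which contains all
    [Gamma] values and cancels; [dirichlet_constS] gives the ratio. *)
Lemma bayes_predictive_dirichlet m n (a : 'I_m.+1 -> R) i
    (x : {ffun 'I_m.+1 -> 'I_n.+1}) :
  (forall j, 0 < a j) -> x \in counts m.+1 n ->
  bayes_predictive (dirichlet a) (unit_count i) x =
    ((x i)%:R + a i) / (n%:R + \sum_j a j).
Proof.
move=> a0; rewrite inE => /eqP xn.
pose c : R := n`!%:R / (\prod_j (x j)`!)%:R * (Gamma (\sum_j a j) / \prod_j Gamma (a j)).
have A0 : 0 < \sum_j a j.
  by rewrite big_ord_recl ltr_pwDl// sumr_ge0// => j _; exact: ltW.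
have c0 : 0 < c.
  rewrite !mulr_gt0 ?invr_gt0 ?ltr0n ?fact_gt0 ?Gamma_gt0//.
    by rewrite prodn_gt0// => j; exact: fact_gt0.
  by apply: prodr_gt0 => j _; exact: Gamma_gt0.
pose b j : R := (x (inord j))%:R + a (inord j).
have b0 j : 0 < b j by rewrite ltr_wpDl.
rewrite /bayes_predictive.
have -> : (fun th => multinomial_pmf th x * dirichlet a th) =
    (fun th => c * \prod_j (th j ^+ x j * th j `^ (a j - 1))).
  apply/funext => th; rewrite /multinomial_pmf /dirichlet big_split/= /c; ring.
have -> : (fun th => obs_pmf th (unit_count i) * (multinomial_pmf th x * dirichlet a th)) =
    (fun th => c * \prod_j (th j ^+ (x j + (j == i)) * th j `^ (a j - 1))).
  apply/funext => th; rewrite /obs_pmf /multinomial_pmf /dirichlet.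
  under [in RHS]eq_bigr => j _ do rewrite exprD -mulrA.
  under eq_bigr do rewrite unit_countE.
  rewrite !big_split/= /c; ring.
rewrite !simplex_integral_monomial ?(ltW c0)//=.
rewrite (@eq_dirichlet_const _ (fun j => b j + (j == i :> nat)%:R)); last first.
  move=> j jm; rewrite natrD addrAC; congr (_ + _%:R).
  by rewrite -val_eqE/= inordK.
have Bsum : \sum_(j < m.+1) b j = n%:R + \sum_j a j.
  rewrite -xn natr_sum -big_split; apply: eq_bigr => j _.
  by rewrite /b inord_val.
have B0 : 0 < n%:R + \sum_j a j by rewrite ltr_wpDl.
have := dirichlet_constS b0 (ltn_ord i : (i <= m)%N).
rewrite -/b Bsum /b inord_val -/b => E.
have D0 := dirichlet_const_gt0 m b0.
have cD0 : c * dirichlet_const b m != 0 by rewrite gt_eqF// (mulr_gt0 c0 D0).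
apply/eqP; rewrite eqr_div// ?(gt_eqF B0)//.
by rewrite -mulrA E mulrCA.
Qed.

End bayes_predictive_dirichlet.

Unset Implicit Arguments.

Theorem theorem1 (R : realType) (k : nat) (hk : (2 <= k)%N)
    (a : 'I_k -> R) (ha : forall i, 0 < a i)
    (eps : nat -> R)
    (heps_decr : nonincreasing_seq eps)
    (heps_lim : eps @ \oo --> (0 : R))
    (hNeps_lim : (fun N : nat => N%:R * eps N) @ \oo --> +oo)
    (heps_range : forall N, 0 < eps N < k%:R^-1) :
  let A := \sum_(i < k) a i in
  exists C : R, \forall N \near \oo,
    (ereal_sup
      [set (`| kl_risk theta (bayes_predictive (n := N) (dirichlet a))
               - (k%:R - 1) / (2 * N%:R)
               - 1 / N%:R ^+ 2 *
                 (\sum_(i < k) 1 / (12 * theta i)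
                    * (6 * a i ^+ 2 - 12 * a i + 5)
                  - 1 / 2 * A ^+ 2 + A - 1 / 2 * k%:R + 1 / 12)
               - 1 / N%:R ^+ 3 *
                 (\sum_(i < k) 1 / (12 * theta i ^+ 2)
                    * (- 4 * a i ^+ 3 + 18 * a i ^+ 2 - 24 * a i + 9)
                  + \sum_(i < k) 1 / (4 * theta i)
                    * (- 6 * a i ^+ 2 + 12 * a i - 5)
                  + 1 / 3 * A ^+ 3 - A + 1 / 2 * k%:R)
               - 1 / N%:R ^+ 4 *
                 (\sum_(i < k) 1 / (120 * theta i ^+ 3)
                    * (30 * a i ^+ 4 - 240 * a i ^+ 3 + 660 * a i ^+ 2
                       - 720 * a i + 251)
                  + \sum_(i < k) 1 / (2 * theta i ^+ 2)
                    * (4 * a i ^+ 3 - 18 * a i ^+ 2 + 24 * a i - 9)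
                  + \sum_(i < k) 1 / (12 * theta i)
                    * (42 * a i ^+ 2 - 84 * a i + 35)
                  - 1 / 4 * A ^+ 4 + A - 1 / 2 * k%:R - 1 / 120) |)%:E
        | theta in simplex_ge (k := k) (eps N)]
     <= (C * (N%:R ^- 5 * eps N ^- 4))%:E)%E.
Proof.
case: k hk a ha heps_range => [//|m] _ a ha heps_range A.
have [C1 C10 H1] := binomial_risk_expansion ha (ltn0Sn m).
have [C2 C20 H2] := risk_main_expansion a (ltn0Sn m).
exists (C1 + C2); near=> N.
(* The divergence of [N * eps N] enters here: it gives [1 <= N * theta i] on all of
   [simplex_ge (eps N)]. *)
have Neps : 1 <= N%:R * eps N by near: N; move/cvgryPge : hNeps_lim; exact.
have N0 : (0 < N)%N by case: (N) Neps => //; rewrite mul0r ler10.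
have /andP[eps0 _] := heps_range N.
apply: ge_ereal_sup => _ [th [[th0 th1] theps] <-]; rewrite lee_fin.
have thpos i : 0 < th i by exact: lt_le_trans (theps i).
have thle1 i : th i <= 1.
  by rewrite -th1 (bigD1 i)//= lerDl sumr_ge0.
rewrite (kl_riskE ha thpos th1); last first.
  by move=> i x; exact: bayes_predictive_dirichlet.
rewrite [X in `|X|](_ : _ = (binomial_risk a th N - risk_main a th N)
  + (risk_main a th N - risk_expansion a th N%:R)); last first.
  by rewrite /risk_expansion -/A; ring.
rewrite mulrDl; apply: (le_trans (ler_normD _ _)); apply: lerD.
  exact: H1.
exact: H2.
Unshelve. all: by end_near. Qed.
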